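(* Let $q\ge 1$, $\gamma_1,\dots,\gamma_q\in\mathbb{R}$ with $\sum_{j=1}^q\gamma_j=T>0$, and $z_1,\dots,z_q\in\mathbb{C}$ with $\operatorname{Im} z_j\neq 0$ for $j=1,\dots,q$. Let $Q(x)=\sum_{j=1}^q\gamma_j\log|x-z_j|$, $x\in\mathbb{R}$, and let $\mu_T$ be the equilibrium measure of mass $T$ on $\mathbb{R}$ in the (weakly admissible) external field $Q$. If $$\sum_{j=1}^q\gamma_j|\operatorname{Im} z_j|<0,$$ then $\operatorname{supp}\mu_T$ is a compact subset of the real axis.
   Context: The equilibrium measure $\mu_T$ of mass $T$ on $\mathbb{R}$ in the external field $Q$ is the unique minimizer, among positive Borel measures $\sigma$ on $\mathbb{R}$ with $\sigma(\mathbb{R})=T$, of the weighted energy $$I_Q(\sigma)=\iint\left(\log\frac{1}{|x-y|}+\frac{Q(x)}{T}+\frac{Q(y)}{T}\right)d\sigma(x)\,d\sigma(y).$$ Here $Q(x)-T\log|x|$ has a finite limit as $|x|\to\infty$, so that $Q$ is weakly admissible for the mass $T$ (meaning $\liminf_{|x|\to\infty}(Q(x)-T\log|x|)=M\in(-\infty,\infty]$); in this situation existence and uniqueness of $\mu_T$ are known, but in general its support need not be compact. *)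

(* Defs.v *)
From mathcomp Require Import all_boot all_order all_algebra.
From mathcomp Require Import all_classical all_reals all_analysis.
From mathcomp.real_closed Require Import complex.

Set Implicit Arguments.
Unset Strict Implicit.
Unset Printing Implicit Defensive.

Import Order.TTheory GRing.Theory Num.Theory.
Import numFieldNormedType.Exports.

Local Open Scope classical_set_scope.
Local Open Scope complex_scope.
Local Open Scope ring_scope.

(* [measurableTypeR R] is R with its Borel sigma-algebra. *)
Notation borel_measure R := {measure set (measurableTypeR R) -> \bar R}.

(* [Normc.normc] is the modulus R[i] -> R; no argument of [ln] vanishes when
   every [z j] is off the real axis. *)
Definition point_charge_field (R : realType) (q : nat)
    (gamma : 'I_q -> R) (z : 'I_q -> R[i]) (x : R) : R :=
  \sum_(j < q) gamma j * ln (Normc.normc (x%:C - z j)).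

(* The kernel is extended-real valued: at x = y, [0^-1 = +oo] in [\bar R], so
   log (1 / |x - y|) is +oo there. *)
Definition energy_kernel (R : realType) (Q : R -> R) (T : R) (x y : R) : \bar R :=
  (lne (`|x - y|%:E)^-1 + (Q x / T)%:E + (Q y / T)%:E)%E.

(* For Q weakly admissible for the mass T, the kernel is bounded below, so for
   measures of mass T the iterated integral is the integral against the product
   measure, with value in ]-oo, +oo]. *)
Definition weighted_energy (R : realType) (Q : R -> R) (T : R)
    (sigma : borel_measure R) : \bar R :=
  (\int[sigma]_y \int[sigma]_x energy_kernel Q T x y)%E.

Definition energy_minimizer (R : realType) (Q : R -> R) (T : R)
    (mu : borel_measure R) : Prop :=
  mu setT = T%:E /\
  forall sigma : borel_measure R, sigma setT = T%:E ->
    (weighted_energy Q T mu <= weighted_energy Q T sigma)%E.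

(* Uniqueness is up to equality on Borel sets: a library measure is a function
   on all sets, with arbitrary values outside the sigma-algebra. *)
Definition is_equilibrium_measure (R : realType) (Q : R -> R) (T : R)
    (mu : borel_measure R) : Prop :=
  energy_minimizer Q T mu /\
  forall nu : borel_measure R, energy_minimizer Q T nu ->
    forall A : set (measurableTypeR R), measurable A -> nu A = mu A.

Definition measure_support (R : realType) (mu : borel_measure R) : set R :=
  [set x | forall U : set R, open U -> U x -> (0 < mu U)%E].

(* Main.v *)
From HB Require Import structures.
Require Import Defs.
From mathcomp Require Import all_boot all_order all_algebra.
From mathcomp Require Import all_classical all_reals all_analysis.
From mathcomp Require Import measurable_realfun.
From mathcomp.real_closed Require Import complex.
From mathcomp Require Import ring lra.
Import Order.TTheory GRing.Theory Num.Theory.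
Import numFieldNormedType.Exports.
Local Open Scope classical_set_scope.
Local Open Scope complex_scope.
Local Open Scope ring_scope.

(** The mass that the equilibrium measure mu has far away can be moved so as to
    lower the energy; hence there is none.

    Lift a point mass from x to x + i e in the upper half-plane and sweep it back
    onto the real line, that is, replace it by the Cauchy distribution of width e
    centred at x.  Integrating a function of the real variable against that
    distribution evaluates its harmonic extension at x + i e
    ([poisson_average_ln]).  For the kernel - ln |x - s| the extension is
    - ln |x + i e - s|, which is smaller.  For the field Q, all of whose charges may be
    reflected into the lower half-plane, the extension at x + i e minus Q x is,
    for large |x|,

      (e S + T e ^+ 2 / 2) / x ^+ 2 + O(1 / |x| ^+ 3),

    where S is the sum of the gamma j * |Im (z j)| ([charge_field_above_lt]).  The
    hypothesis S < 0 makes this negative for a suitable e > 0 and all |x| > A.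

    Let B be a bounded set of points with |x| > A, and let nu arise from mu by
    sweeping the mass of B in this way.  The potentials satisfy
    U^nu <= U^mu - eta * mu B everywhere for some eta > 0, where the potential U is the
    integral of the energy kernel, field included.  Integrating this inequality
    against nu, and then against mu, gives
    I(nu) <= I(mu) - eta * mu B * T ([energy_le_of_potential_le]), so minimality of the
    finite number I(mu) forces mu B = 0 ([minimizer_null_of_field_drop]).  Therefore
    the support lies in the segment from - A to A.

    The analytic core is the Poisson formula for ln ((u - a) ^+ 2 + d ^+ 2).  It follows
    from the semigroup property of the Cauchy distributions
    ([poisson_kernel_conv], by partial fractions), because the logarithm is an
    integral over the heights b >= d of rational functions that are, up to constants,
    Poisson kernels ([integral_poisson_kernel_ln_incr]). *)

(** * Integrals computed from antiderivatives *)

Lemma ge0_integral_half_line (R : realType) (f F : R -> R) (a l : R) :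
  (forall x, a <= x -> 0 <= f x) ->
  (forall x, a <= x -> {for x, continuous f}) ->
  (forall x : R, a <= x -> is_derive x 1 F (f x)) ->
  F x @[x --> +oo] --> l ->
  (\int[lebesgue_measure]_(x in `[a, +oo[) (f x)%:E = (l - F a)%:E)%E.
Proof.
move=> f0 cf dF Fl; rewrite (ge0_continuous_FTC2y f0 _ Fl) -?EFinB//.
- apply/continuous_within_itvcyP; split.
    by move=> x; rewrite in_itv/= andbT => /ltW /cf.
  by apply: cvg_at_right_filter; exact: cf.
- by move=> x /ltW /dF dFx; exact: ex_derive.
- apply: cvg_at_right_filter; apply: differentiable_continuous.
  by apply/derivable1_diffP; have dFa := dF _ (lexx a); exact: ex_derive.
- move=> x; rewrite in_itv/= andbT => /ltW /dF dFx.
  by rewrite derive1E; exact: derive_val.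
Qed.

Lemma ge0_integral_line (R : realType) (f F : R -> R) (l m : R) :
  (forall x, 0 <= f x) -> continuous f -> (forall x : R, is_derive x 1 F (f x)) ->
  F x @[x --> +oo] --> l -> F (- x) @[x --> +oo] --> m ->
  (\int[lebesgue_measure]_x (f x)%:E = (l - m)%:E)%E.
Proof.
move=> f0 cf dF Fl Fm.
have mf : measurable_fun [set: R] (EFin \o f).
  by apply/measurable_EFinP; exact: continuous_measurable_fun.
have cNf : continuous (f \o -%R).
  by move=> x; apply: continuous_comp; [exact: opp_continuous|exact: cf].
have neg : (\int[lebesgue_measure]_(x in `]-oo, 0%R]) (f x)%:E = (F 0 - m)%:E)%E.
  transitivity (\int[lebesgue_measure]_(x in `]-oo, 0%R])
      ((EFin \o f \o -%R) (- x)%R))%E.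
    by apply: eq_integral => x _ /=; rewrite opprK.
  rewrite -ge0_integration_by_substitution0; last 2 first.
  - by apply/measurable_EFinP; exact: continuous_measurable_fun.
  - by move=> r; rewrite lee_fin f0.
  have dNF (x : R) : 0 <= x -> is_derive x 1 (fun x => - F (- x)) ((f \o -%R) x).
    move=> _; have -> : (fun x => - F (- x)) = - (F \o -%R) by [].
    have d1 := dF (- x); have d2 := is_deriveN (is_derive_id x (1 : R)).
    have d3 := is_deriveN (is_derive1_comp d1 d2).
    by apply: is_derive_eq d3 _; rewrite mulrN1 opprK.
  have := ge0_integral_half_line _ _ _ _ _ _ _ dNF (cvgN Fm).
  move=> ->; last by move=> x _; exact: cNf.
  - by rewrite oppr0 opprK addrC.
  - by move=> x _; exact: f0.
rewrite -(setUv `]-oo, 0%R]%classic) ge0_integral_setU//=; last 4 first.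
- exact: measurableC.
- by rewrite setUv.
- by move=> x _; rewrite lee_fin.
- exact/disj_setPCl.
rewrite neg setCitvl.
rewrite integral_itv_obnd_cbnd; last by apply: measurable_funTS.
have := ge0_integral_half_line _ _ _ 0 _ _ _ (fun x _ => dF x) Fl.
move=> ->; [|by move=> *; exact: f0|by move=> *; exact: cf].
by rewrite -EFinD; congr EFin; ring.
Qed.

(** * Logarithms, arctangents and their behaviour at infinity *)

Lemma sqrD_sqr_gt0 (R : realType) (u b : R) : b != 0 -> 0 < u ^+ 2 + b ^+ 2.
Proof. by move=> b0; rewrite ltr_wpDl ?sqr_ge0// exprn_even_gt0. Qed.

Lemma is_derive_sqrD_sqr (R : realType) (a b u : R) :
  is_derive u 1 (fun v : R => (v - a) ^+ 2 + b ^+ 2) (2 * (u - a)).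
Proof.
have -> : (fun v : R => (v - a) ^+ 2 + b ^+ 2) =
  (id - cst a) ^+ 2 + cst (b ^+ 2) :> (R -> R) by [].
by apply: is_derive_eq; rewrite /= ?fctE /GRing.scale/=; ring.
Qed.

Lemma is_derive_ln_sqr (R : realType) (a b u : R) :
  0 < (u - a) ^+ 2 + b ^+ 2 ->
  is_derive u 1 (fun v : R => ln ((v - a) ^+ 2 + b ^+ 2))
    (2 * (u - a) / ((u - a) ^+ 2 + b ^+ 2)).
Proof.
move=> p0.
have d1 := is_derive1_ln p0; have d2 := is_derive_sqrD_sqr R a b u.
have d3 := @is_derive1_comp _ _ (fun v : R => (v - a) ^+ 2 + b ^+ 2) _ _ _ d1 d2.
by apply: is_derive_eq d3 _; rewrite mulrC.
Qed.

Lemma is_derive_atan_scaled (R : realType) (a b u : R) : b != 0 ->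
  is_derive u 1 (fun v : R => atan ((v - a) / b)) (b / ((u - a) ^+ 2 + b ^+ 2)).
Proof.
move=> b0.
have d2 : is_derive u 1 (fun v : R => (v - a) / b) b^-1.
  have -> : (fun v : R => (v - a) / b) = b^-1 *: (id - cst a) :> (R -> R).
    by apply/funext => v; rewrite /= mulrC.
  by apply: is_derive_eq; rewrite /= ?fctE /GRing.scale/=; ring.
have d1 := is_derive1_atan ((u - a) / b).
have d3 := @is_derive1_comp _ _ (fun v : R => (v - a) / b) _ _ _ d1 d2.
apply: is_derive_eq d3 _.
have := sqrD_sqr_gt0 R (u - a) b b0; move/lt0r_neq0 => h.
have h' : 1 + ((u - a) / b) ^+ 2 != 0.
  by rewrite gt_eqF// ltr_pwDl// sqr_ge0.
by field; rewrite b0 h.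
Qed.

Lemma cvgy_inv (R : realType) : (fun u : R => u^-1) u @[u --> +oo] --> (0 : R).
Proof.
apply/cvgrPdist_lt => e e0; near=> u; rewrite sub0r normrN.
have u0 : 0 < u by near: u; exact: nbhs_pinfty_gt (num_real _).
rewrite ger0_norm ?invr_ge0 ?ltW// invf_plt ?posrE//.
by near: u; exact: nbhs_pinfty_gt (num_real _).
Unshelve. all: by end_near. Qed.

Lemma near_eq_cvg_to {R : realType} {F : set_system R} {FF : Filter F}
    (f g : R -> R) (l : R) :
  (\forall u \near F, f u = g u) -> f u @[u --> F] --> l ->
  g u @[u --> F] --> l.
Proof. by move=> fg; apply: cvg_trans; exact: near_eq_cvg. Qed.

(** Both logarithms are 2 ln u + o(1), as the substitution t = 1 / u shows. *)
Lemma cvgy_ln_sqr_sub (R : realType) (a b c d : R) :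
  (fun u : R => ln ((u - a) ^+ 2 + b ^+ 2) - ln ((u - c) ^+ 2 + d ^+ 2)) u
    @[u --> +oo] --> (0 : R).
Proof.
suff H (x e : R) : (fun u : R => ln ((u - x) ^+ 2 + e ^+ 2) - ln (u ^+ 2)) u
    @[u --> +oo] --> (0 : R).
  pose f x e (u : R) := ln ((u - x) ^+ 2 + e ^+ 2) - ln (u ^+ 2).
  have h : (fun u => f a b u - f c d u) u @[u --> +oo] --> (0 : R).
    by rewrite -[X in _ --> X]subr0; apply: cvgB; exact: H.
  apply: near_eq_cvg_to h; rewrite /f.
  by near=> u; lra.
pose g (t : R) : R := (1 - x * t) * (1 - x * t) + (e * t) * (e * t).
have cg : continuous g.
  have cM (y : R) : continuous (fun t => y * t).
    by move=> t; apply: cvgM; [exact: cvg_cst|exact: cvg_id].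
  have cB : continuous (fun t => 1 - x * t).
    by move=> t; apply: cvgB; [exact: cvg_cst|exact: cM].
  by move=> t; apply: cvgD; apply: cvgM; first [exact: cB|exact: cM].
have cl : (fun t : R => ln (g t)) t @[t --> (0 : R)] --> (0 : R).
  have g0 : g 0 = 1 by rewrite /g !mulr0 subr0 mulr1 addr0.
  rewrite -[X in _ --> X]ln1 -g0; apply: (cvg_comp g (@ln R)); first exact: cg.
  by apply: continuous_ln; rewrite g0.
have h : (fun u => ln (g u^-1)) u @[u --> +oo] --> (0 : R).
  exact: cvg_comp _ _ (cvgy_inv R) cl.
apply: near_eq_cvg_to h.
near=> u => /=.
have u0 : 0 < u by near: u; exact: nbhs_pinfty_gt (num_real _).
have ux : 0 < u - x.
  by rewrite subr_gt0; near: u; exact: nbhs_pinfty_gt (num_real _).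
rewrite -ln_div ?posrE ?exprn_gt0//; last by rewrite ltr_pwDl ?sqr_ge0 ?exprn_gt0.
congr ln; rewrite /g; have := lt0r_neq0 u0 => u0'; field.
Unshelve. all: by end_near. Qed.

Lemma cvgy_atan_scaled (R : realType) (a b : R) : 0 < b ->
  (fun u : R => atan ((u - a) / b)) u @[u --> +oo] --> pi / 2.
Proof.
move=> b0.
have h : (fun u : R => (u - a) / b) u @[u --> +oo] --> +oo.
  apply/cvgryPge => A; near=> u.
  rewrite ler_pdivlMr// lerBrDr.
  by near: u; exact: nbhs_pinfty_ge (num_real _).
exact: cvg_comp _ _ h (@cvgy_atan R).
Unshelve. all: by end_near. Qed.

(** * The Poisson kernel and its semigroup property *)

(** Poisson kernel of the upper half-plane: as a function of u, the harmonic
    measure of the real line seen from x + i e. *)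
Definition poisson_kernel (R : realType) (e x u : R) : R :=
  e / (pi * ((u - x) ^+ 2 + e ^+ 2)).

Lemma poisson_kernel_gt0 (R : realType) (e x u : R) :
  0 < e -> 0 < poisson_kernel R e x u.
Proof.
by move=> e0; rewrite divr_gt0// mulr_gt0 ?pi_gt0// sqrD_sqr_gt0// gt_eqF.
Qed.

Lemma continuous_poisson_kernel (R : realType) (e x : R) :
  0 < e -> continuous (poisson_kernel R e x).
Proof.
move=> e0 u; apply: cvgM; first exact: cvg_cst.
apply: cvgV.
  by rewrite gt_eqF// mulr_gt0 ?pi_gt0// sqrD_sqr_gt0// gt_eqF.
apply: cvgM; first exact: cvg_cst.
have d := is_derive_sqrD_sqr R x e u.
have /derivable1_diffP/differentiable_continuous := @ex_derive _ _ _ _ _ _ _ d.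
exact.
Qed.

Lemma integral_poisson_kernel (R : realType) (e x : R) : 0 < e ->
  (\int[lebesgue_measure]_u (poisson_kernel R e x u)%:E = 1)%E.
Proof.
move=> e0; have en0 : e != 0 by rewrite gt_eqF.
have pi0 : pi != 0 :> R by rewrite gt_eqF// pi_gt0.
pose F (u : R) := pi^-1 * atan ((u - x) / e).
rewrite (_ : 1%E = (pi^-1 * (pi / 2) - pi^-1 * - (pi / 2))%:E); last first.
  by congr EFin; have := pi0; generalize (@pi R) => w w0; field.
have dF (u : R) : is_derive u 1 F (poisson_kernel R e x u).
  have d1 := is_derive_atan_scaled R x e u en0.
  have d2 := is_deriveZ pi^-1 d1.
  apply: is_derive_eq d2 _; rewrite /GRing.scale/= /poisson_kernel.
  have := pi0; generalize (@pi R) => w w0.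
  by field; rewrite w0 (gt_eqF (sqrD_sqr_gt0 _ _ _ en0)).
apply: (ge0_integral_line _ _ F) => //.
- by move=> u; exact/ltW/poisson_kernel_gt0.
- exact: continuous_poisson_kernel.
- by apply: cvgM; [exact: cvg_cst|exact: cvgy_atan_scaled].
- apply: cvgM; first exact: cvg_cst.
  have -> : (fun u => atan ((- u - x) / e)) = - (fun u => atan ((u - - x) / e)).
    apply/funext => u; rewrite fctE -atanN; congr atan; field.
    exact: en0.
  by apply: cvgN; exact: cvgy_atan_scaled.
Qed.

Lemma cvgy_div_sqrD_sqr (R : realType) (x e : R) :
  (fun u : R => (u - x) / ((u - x) ^+ 2 + e ^+ 2)) u @[u --> +oo] --> (0 : R).
Proof.
have h : (fun u : R => u - x) u @[u --> +oo] --> +oo by exact: cvg_addrr.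
suff H : (fun v : R => v / (v ^+ 2 + e ^+ 2)) v @[v --> +oo] --> (0 : R).
  exact: cvg_comp _ _ h H.
apply: (@squeeze_cvgr _ _ _ _ (cst 0) (fun v : R => v^-1)).
- near=> v.
  have v0 : 0 < v by near: v; exact: nbhs_pinfty_gt (num_real _).
  have p0 : 0 < v ^+ 2 + e ^+ 2 by rewrite ltr_pwDl ?sqr_ge0 ?exprn_gt0.
  apply/andP; split; first by rewrite divr_ge0// ltW.
  by rewrite ler_pdivrMr// ler_pdivlMl// -expr2 lerDl sqr_ge0.
- exact: cvg_cst.
- exact: cvgy_inv.
Unshelve. all: by end_near. Qed.

(** Partial fractions give an antiderivative made of logarithms and arctangents.
    The denominator of its coefficients is s * t, and t vanishes exactly when the
    two kernels coincide; that case has another antiderivative. *)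
Lemma poisson_kernel_conv_off_diagonal (R : realType) (e b x a : R) :
  0 < e -> 0 < b -> (x != a) || (e != b) ->
  (\int[lebesgue_measure]_u (poisson_kernel R e x u * poisson_kernel R b a u)%:E
    = (poisson_kernel R (e + b) x a)%:E)%E.
Proof.
move=> e0 b0 xaeb.
have en0 : e != 0 by rewrite gt_eqF.
have bn0 : b != 0 by rewrite gt_eqF.
have pi0 : pi != 0 :> R by rewrite gt_eqF// pi_gt0.
pose s := (a - x) ^+ 2 + (e + b) ^+ 2.
pose t := (a - x) ^+ 2 + (e - b) ^+ 2.
have sn0 : s != 0 by rewrite gt_eqF// sqrD_sqr_gt0// gt_eqF// addr_gt0.
have tn0 : t != 0.
  rewrite /t; case/orP: xaeb => h; rewrite gt_eqF//; last first.
    by rewrite sqrD_sqr_gt0// subr_eq0.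
  by rewrite addrC sqrD_sqr_gt0// subr_eq0 eq_sym.
pose k := e * b / (pi ^+ 2 * (s * t)).
pose B := ((a - x) ^+ 2 + b ^+ 2 - e ^+ 2) / e.
pose D := ((a - x) ^+ 2 + e ^+ 2 - b ^+ 2) / b.
pose F (u : R) := k * ((a - x) * (ln ((u - x) ^+ 2 + e ^+ 2) -
   ln ((u - a) ^+ 2 + b ^+ 2)) + B * atan ((u - x) / e) + D * atan ((u - a) / b)).
pose L := k * (0 + B * (pi / 2) + D * (pi / 2)).
rewrite (_ : poisson_kernel R (e + b) x a = L - (- L)); last first.
  move: sn0 tn0; rewrite /L /k /B /D /poisson_kernel /s /t => s0 t0.
  have := pi0; generalize (@pi R) => w w0; field.
  by rewrite w0 s0 t0 en0 bn0.
have dF (u : R) : is_derive u 1 F (poisson_kernel R e x u * poisson_kernel R b a u).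
  have p0 := sqrD_sqr_gt0 R (u - x) e en0; have q0 := sqrD_sqr_gt0 R (u - a) b bn0.
  have d1 := is_derive_ln_sqr R x e u p0; have d2 := is_derive_ln_sqr R a b u q0.
  have d3 := is_derive_atan_scaled R x e u en0.
  have d4 := is_derive_atan_scaled R a b u bn0.
  have d5 := is_deriveZ (a - x) (is_deriveD d1 (is_deriveN d2)).
  have d6 := is_deriveZ k
    (is_deriveD (is_deriveD d5 (is_deriveZ B d3)) (is_deriveZ D d4)).
  apply: is_derive_eq d6 _; rewrite /GRing.scale/= /poisson_kernel /k.
  have := lt0r_neq0 p0; have := lt0r_neq0 q0; move: tn0 sn0 => + + pn qn.
  rewrite /B /D /s /t => tn0 sn0.
  have := pi0; generalize (@pi R) => w w0; field.
  by rewrite w0 tn0 sn0 en0 bn0 pn qn.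
apply: (ge0_integral_line _ _ F) => //.
- by move=> u; apply: mulr_ge0; exact/ltW/poisson_kernel_gt0.
- by move=> u; apply: cvgM; exact: continuous_poisson_kernel.
- apply: cvgM; first exact: cvg_cst.
  apply: cvgD; last by apply: cvgM; [exact: cvg_cst|exact: cvgy_atan_scaled].
  apply: cvgD; last by apply: cvgM; [exact: cvg_cst|exact: cvgy_atan_scaled].
  rewrite -[X in _ --> X](mulr0 (a - x)).
  by apply: cvgM; [exact: cvg_cst|exact: cvgy_ln_sqr_sub].
- have -> : - L = k * ((a - x) * 0 + B * - (pi / 2) + D * - (pi / 2)).
    by rewrite /L; ring.
  have atanE (y c : R) : c != 0 -> (fun u => atan ((- u - y) / c)) =
      - (fun u => atan ((u - - y) / c)).
    move=> c0; apply/funext => u; rewrite fctE -atanN; congr atan; field.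
    exact: c0.
  apply: cvgM; first exact: cvg_cst.
  apply: cvgD; last first.
    apply: cvgM; first exact: cvg_cst.
    by rewrite atanE//; apply: cvgN; exact: cvgy_atan_scaled.
  apply: cvgD; last first.
    apply: cvgM; first exact: cvg_cst.
    by rewrite atanE//; apply: cvgN; exact: cvgy_atan_scaled.
  apply: cvgM; first exact: cvg_cst.
  have -> : (fun u => ln ((- u - x) ^+ 2 + e ^+ 2) - ln ((- u - a) ^+ 2 + b ^+ 2)) =
    (fun u => ln ((u - - x) ^+ 2 + e ^+ 2) - ln ((u - - a) ^+ 2 + b ^+ 2)).
    by apply/funext => u; congr (ln _ - ln _); ring.
  exact: cvgy_ln_sqr_sub.
Qed.

Lemma poisson_kernel_conv_diagonal (R : realType) (e x : R) : 0 < e ->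
  (\int[lebesgue_measure]_u (poisson_kernel R e x u * poisson_kernel R e x u)%:E
    = (poisson_kernel R (e + e) x x)%:E)%E.
Proof.
move=> e0; have en0 : e != 0 by rewrite gt_eqF.
have pi0 : pi != 0 :> R by rewrite gt_eqF// pi_gt0.
pose A : R := (2 * pi ^+ 2)^-1.
pose B := (2 * e * pi ^+ 2)^-1.
pose F (u : R) := A * ((u - x) / ((u - x) ^+ 2 + e ^+ 2)) + B * atan ((u - x) / e).
pose L := A * 0 + B * (pi / 2).
rewrite (_ : poisson_kernel R (e + e) x x = L - (- L)); last first.
  have en2 : e + e != 0 by rewrite gt_eqF// addr_gt0.
  rewrite /L /A /B /poisson_kernel; have := pi0; generalize (@pi R) => w w0; field.
  by rewrite w0 en0 subrr expr0n/= add0r expf_neq0.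
have dF (u : R) : is_derive u 1 F (poisson_kernel R e x u * poisson_kernel R e x u).
  have q0 := lt0r_neq0 (sqrD_sqr_gt0 R (u - x) e en0).
  have d1 := @is_deriveV _ (fun v : R => (v - x) ^+ 2 + e ^+ 2) _ _ _ q0
    (is_derive_sqrD_sqr R x e u).
  have d0 : is_derive u 1 (id - cst x : R -> R) 1.
    by apply: is_derive_eq; rewrite subr0.
  have d3 := is_derive_atan_scaled R x e u en0.
  have d4 := is_deriveD (is_deriveZ A (is_deriveM d0 d1)) (is_deriveZ B d3).
  apply: is_derive_eq d4 _; rewrite /GRing.scale/= ?fctE /poisson_kernel /A /B.
  have := pi0; generalize (@pi R) => w w0; field.
  by rewrite w0 q0 en0.
apply: (ge0_integral_line _ _ F) => //.
- by move=> u; apply: mulr_ge0; exact/ltW/poisson_kernel_gt0.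
- by move=> u; apply: cvgM; exact: continuous_poisson_kernel.
- apply: cvgD; last by apply: cvgM; [exact: cvg_cst|exact: cvgy_atan_scaled].
  by apply: cvgM; [exact: cvg_cst|exact: cvgy_div_sqrD_sqr].
- have -> : - L = A * (- 0) + B * - (pi / 2) by rewrite /L; ring.
  apply: cvgD; apply: cvgM; try exact: cvg_cst.
    have -> : (fun u => (- u - x) / ((- u - x) ^+ 2 + e ^+ 2)) =
      - (fun u => (u - - x) / ((u - - x) ^+ 2 + e ^+ 2)).
      apply/funext => u; rewrite fctE -mulNr; congr (_ / _); ring.
    by apply: cvgN; exact: cvgy_div_sqrD_sqr.
  have -> : (fun u => atan ((- u - x) / e)) = - (fun u => atan ((u - - x) / e)).
    by apply/funext => u; rewrite fctE -atanN; congr atan; field.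
  by apply: cvgN; exact: cvgy_atan_scaled.
Qed.

(** Semigroup property: leaving height e + b downwards, one passes through
    height b first. *)
Lemma poisson_kernel_conv (R : realType) (e b x a : R) : 0 < e -> 0 < b ->
  (\int[lebesgue_measure]_u (poisson_kernel R e x u * poisson_kernel R b a u)%:E
    = (poisson_kernel R (e + b) x a)%:E)%E.
Proof.
move=> e0 b0; have [|] := boolP ((x != a) || (e != b)).
  exact: poisson_kernel_conv_off_diagonal.
rewrite negb_or !negbK => /andP[/eqP <- /eqP <-].
exact: poisson_kernel_conv_diagonal.
Qed.

(** * The Poisson formula for logarithms *)

Lemma measurable_funV_gt0 d (T : measurableType d) (R : realType) (f : T -> R) :
  measurable_fun setT f -> (forall x, 0 < f x) ->
  measurable_fun setT (fun x => (f x)^-1).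
Proof.
move=> mf f0; have -> : (fun x => (f x)^-1) = (fun x => expR (- ln (f x))).
  by apply/funext => x; rewrite expRN lnK// posrE.
apply: measurableT_comp; first exact: measurable_expR.
apply: measurable_funN; apply: measurableT_comp => //; exact: measurable_ln.
Qed.

(** The derivative in b of ln (b ^+ 2) - ln (c ^+ 2 + (b + e) ^+ 2).  Subtracting
    the two logarithms makes the integrals over all large b converge, and the
    difference is nonnegative, so Tonelli applies without integrability
    hypotheses. *)
Definition log_drift (R : realType) (e c b : R) : R :=
  2 / b - 2 * (b + e) / (c ^+ 2 + (b + e) ^+ 2).

Lemma log_drift_ge0 (R : realType) (e c b : R) : 0 <= e -> 0 < b ->
  0 <= log_drift R e c b.
Proof.
move=> e0 b0.
have p0 : 0 < c ^+ 2 + (b + e) ^+ 2 by rewrite sqrD_sqr_gt0// gt_eqF// ltr_wpDr.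
rewrite subr_ge0 ler_pdivrMr// mulrAC ler_pdivlMr//.
rewrite -mulrA ler_pM2l//.
have : 0 <= e * b by rewrite mulr_ge0// ltW.
nra.
Qed.

Lemma integral_log_drift (R : realType) (e c d : R) : 0 <= e -> 0 < d ->
  (\int[lebesgue_measure]_(b in `[d, +oo[) (log_drift R e c b)%:E =
   (ln (c ^+ 2 + (d + e) ^+ 2) - ln (d ^+ 2))%:E)%E.
Proof.
move=> e0 d0.
pose F (b : R) := ln ((b - 0) ^+ 2 + 0 ^+ 2) - ln ((b - - e) ^+ 2 + c ^+ 2).
have Fd : 0 - F d = ln (c ^+ 2 + (d + e) ^+ 2) - ln (d ^+ 2).
  rewrite /F subr0 expr0n/= addr0 opprK sub0r opprB.
  by rewrite [in RHS]addrC [in LHS]addrC [c ^+ 2 + _]addrC.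
have gt0 b : d <= b -> 0 < b by exact: lt_le_trans.
have p0 b : d <= b -> 0 < (b - - e) ^+ 2 + c ^+ 2.
  by move=> /gt0 b0; rewrite addrC sqrD_sqr_gt0// opprK gt_eqF// ltr_wpDr.
rewrite -Fd.
have dF (b : R) : d <= b -> is_derive b 1 F (log_drift R e c b).
  move=> db; have b0 := gt0 _ db.
  have q0 : 0 < (b - 0) ^+ 2 + 0 ^+ 2 by rewrite subr0 expr0n/= addr0 exprn_gt0.
  have d5 := is_deriveD (is_derive_ln_sqr R 0 0 b q0)
    (is_deriveN (is_derive_ln_sqr R (- e) c b (p0 _ db))).
  apply: is_derive_eq d5 _; rewrite /log_drift subr0 expr0n/= addr0 opprK.
  rewrite [c ^+ 2 + _]addrC; congr (_ - _).
  by field; rewrite gt_eqF.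
have cF (b : R) : d <= b -> {for b, continuous (log_drift R e c)}.
  move=> db; have b0 := gt0 _ db.
  have cD : continuous (fun x : R => x + e).
    by move=> x; apply: cvgD; [exact: cvg_id|exact: cvg_cst].
  apply: cvgB.
    by apply: cvgM; [exact: cvg_cst|apply: cvgV; [rewrite gt_eqF|exact: cvg_id]].
  apply: cvgM; first by apply: cvgM; [exact: cvg_cst|exact: cD].
  apply: cvgV.
    by rewrite gt_eqF// sqrD_sqr_gt0// gt_eqF// ltr_wpDr.
  apply: cvgD; first exact: cvg_cst.
  under eq_fun do rewrite expr2.
  by rewrite expr2; apply: cvgM; exact: cD.
apply: (ge0_integral_half_line _ _ _ _ _ _ cF dF).
- by move=> b /gt0 b0; exact: log_drift_ge0.
- exact: cvgy_ln_sqr_sub.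
Qed.

Lemma log_drift_poisson_kernel (R : realType) (e x a b : R) : 0 < b + e ->
  log_drift R e (x - a) b = 2 / b - 2 * pi * poisson_kernel R (e + b) x a.
Proof.
move=> be0; have q0 : (x - a) ^+ 2 + (b + e) ^+ 2 != 0.
  by rewrite gt_eqF// sqrD_sqr_gt0// gt_eqF.
have qE : (a - x) ^+ 2 + (e + b) ^+ 2 = (x - a) ^+ 2 + (b + e) ^+ 2 by ring.
rewrite /log_drift /poisson_kernel qE; congr (_ - _).
have pi0 : pi != 0 :> R by rewrite gt_eqF// pi_gt0.
by have := pi0; generalize (@pi R) => w w0; field; rewrite q0.
Qed.

Lemma integrable_poisson_kernel (R : realType) (e x : R) : 0 < e ->
  lebesgue_measure.-integrable [set: R] (EFin \o poisson_kernel R e x).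
Proof.
move=> e0; apply/integrableP; split.
  apply/measurable_EFinP; apply: continuous_measurable_fun.
  exact: continuous_poisson_kernel.
under eq_integral do rewrite /= ger0_norm ?(ltW (poisson_kernel_gt0 _ _ _ _ e0))//.
by rewrite integral_poisson_kernel// ltry.
Qed.

Lemma integral_poisson_kernel_log_drift (R : realType) (e x a b : R) :
  0 < e -> 0 < b ->
  (\int[lebesgue_measure]_u (poisson_kernel R e x u * log_drift R 0 (u - a) b)%:E
   = (log_drift R e (x - a) b)%:E)%E.
Proof.
move=> e0 b0; have be0 : 0 < b + e by rewrite addr_gt0.
pose f (u : R) := 2 / b * poisson_kernel R e x u.
pose g (u : R) := 2 * pi * (poisson_kernel R e x u * poisson_kernel R b a u).
have mc (e' y : R) : 0 < e' -> measurable_fun [set: R] (poisson_kernel R e' y).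
  by move=> ?; apply: continuous_measurable_fun; exact: continuous_poisson_kernel.
have iC : lebesgue_measure.-integrable [set: R]
    (fun u => (poisson_kernel R e x u * poisson_kernel R b a u)%:E).
  apply/integrableP; split.
    by apply/measurable_EFinP; apply: measurable_funM; exact: mc.
  under eq_integral.
    move=> u _; rewrite /= ger0_norm; last first.
      by apply: mulr_ge0; exact/ltW/poisson_kernel_gt0.
    over.
  by rewrite poisson_kernel_conv// ltry.
have iP := integrable_poisson_kernel R e x e0.
transitivity (\int[lebesgue_measure]_u ((f u)%:E - (g u)%:E))%E.
  apply: eq_integral => u _; rewrite -EFinB; congr EFin.
  rewrite log_drift_poisson_kernel ?addr0// add0r /f /g [poisson_kernel R b u a](_ : _ =
    poisson_kernel R b a u); first by ring.
  by rewrite /poisson_kernel -[(a - u)]opprB sqrrN.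
rewrite integralB_EFin//; last 2 first.
- have := integrableZl measurableT (2 / b) iP; exact.
- have := integrableZl measurableT (2 * pi) iC; exact.
rewrite /f /g; under eq_integral do rewrite EFinM.
under [in X in (_ - X)%E]eq_integral do rewrite EFinM.
rewrite !integralZl// integral_poisson_kernel// poisson_kernel_conv//.
by rewrite mule1 -EFinM -EFinB log_drift_poisson_kernel.
Qed.

(** Tonelli turns the semigroup property into the harmonicity of the
    logarithm: the logarithm is the integral of [log_drift] over the heights
    above d, and averaging a slice against the Poisson kernel of height e raises
    it by e. *)
Lemma integral_poisson_kernel_ln_incr (R : realType) (e x a d : R) :
  0 < e -> 0 < d ->
  (\int[lebesgue_measure]_u
     (poisson_kernel R e x u * (ln ((u - a) ^+ 2 + d ^+ 2) - ln (d ^+ 2)))%:E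
   = (ln ((x - a) ^+ 2 + (d + e) ^+ 2) - ln (d ^+ 2))%:E)%E.
Proof.
move=> e0 d0; pose D : set R := [set` `[d, +oo[%R].
have mD : measurable (D : set (measurableTypeR R)) by exact: measurable_itv.
(* Truncating b below at d keeps every denominator positive, which makes the
   two-variable integrand measurable on the whole plane. *)
pose m (b : R) : R := Num.max d b.
have m0 (b : R) : 0 < m b by rewrite lt_max d0.
have mE (b : R) : D b -> m b = b.
  by rewrite /D/= in_itv/= andbT /m => db; apply/max_idPr.
pose g (u b : R) := poisson_kernel R e x u * log_drift R 0 (u - a) (m b) * \1_D b.
have g0 u b : 0 <= g u b.
  apply: mulr_ge0 => //; apply: mulr_ge0; last exact: log_drift_ge0.
  exact/ltW/poisson_kernel_gt0.
have mh d' (T : measurableType d') (f h : T -> R) : measurable_fun setT f ->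
    measurable_fun setT h ->
    measurable_fun setT (fun t => log_drift R 0 (f t) (m (h t))).
  move=> mf mh; have mmh : measurable_fun setT (fun t => m (h t)).
    by apply: measurable_maxr.
  rewrite /log_drift; apply: measurable_funB.
    by apply: measurable_funM => //; exact: measurable_funV_gt0.
  apply: measurable_funM.
    by apply: measurable_funM => //; exact: measurable_funD.
  apply: measurable_funV_gt0.
    apply: measurable_funD; first exact: measurable_funX.
    by apply: measurable_funX; exact: measurable_funD.
  by move=> z; rewrite addr0 sqrD_sqr_gt0// gt_eqF.
have gE u b : ((fun b => (poisson_kernel R e x u * log_drift R 0 (u - a) b)%:E) \_ D) b
    = (g u b)%:E.
  rewrite /g patchE indicE; case: ifPn => bD; last by rewrite mulr0.
  by rewrite mulr1 mE//; move: bD; rewrite inE.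
have mg : measurable_fun [set: measurableTypeR R * measurableTypeR R]
    (fun z => (g z.1 z.2)%:E).
  apply/measurable_EFinP; apply: measurable_funM; last first.
    apply: measurableT_comp; last exact: measurable_snd.
    exact: measurable_indic.
  apply: measurable_funM.
    apply: measurableT_comp; last exact: measurable_fst.
    by apply: continuous_measurable_fun; exact: continuous_poisson_kernel.
  apply: mh; last exact: measurable_snd.
  by apply: measurable_funB => //; exact: measurable_fst.
transitivity (\int[lebesgue_measure]_u \int[lebesgue_measure]_b (g u b)%:E)%E.
  apply: eq_integral => u _; under [RHS]eq_integral do rewrite -gE.
  rewrite -integral_mkcond; under eq_integral do rewrite EFinM.
  have P0 := ltW (poisson_kernel_gt0 R e x u e0).
  rewrite ge0_integralZl//.
  - by rewrite integral_log_drift// addr0 EFinM.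
  - apply/measurable_EFinP.
    apply: (eq_measurable_fun (fun b => log_drift R 0 (u - a) (m b))).
      by move=> b; rewrite inE => /mE ->.
    by apply: measurable_funTS; exact: mh.
  - move=> b; rewrite /D/= in_itv/= andbT => db.
    by rewrite lee_fin log_drift_ge0// (lt_le_trans d0).
transitivity (\int[lebesgue_measure]_b \int[lebesgue_measure]_u (g u b)%:E)%E.
  have G0 (z : measurableTypeR R * measurableTypeR R) : (0 <= (g z.1 z.2)%:E)%E.
    by rewrite lee_fin.
  have := @fubini_tonelli _ _ _ _ R lebesgue_measure lebesgue_measure _ mg G0.
  exact.
transitivity (\int[lebesgue_measure]_(b in D) (log_drift R e (x - a) b)%:E)%E.
  rewrite [RHS]integral_mkcond; apply: eq_integral => b _.
  rewrite patchE; case: ifPn => bD.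
    rewrite -integral_poisson_kernel_log_drift//; last first.
      by move: bD; rewrite inE /D/= in_itv/= andbT; exact: lt_le_trans.
    apply: eq_integral => u _; rewrite /g indicE bD mulr1 mE//.
    by move: bD; rewrite inE.
  by rewrite integral0_eq// => u _; rewrite /g indicE (negbTE bD) mulr0.
by rewrite integral_log_drift// ltW.
Qed.

(** * Poisson averages of fields of point charges *)

(** For f harmonically extended to the upper half-plane, v is the value at
    x + i e; integrability is included so that averages add up. *)
Definition has_poisson_average (R : realType) (e x : R) (f : R -> R) (v : R) :=
  lebesgue_measure.-integrable [set: R] (fun u => (poisson_kernel R e x u * f u)%:E) /\
  (\int[lebesgue_measure]_u (poisson_kernel R e x u * f u)%:E = v%:E)%E.

Lemma poisson_average_cst (R : realType) (e x c : R) : 0 < e ->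
  has_poisson_average R e x (cst c) c.
Proof.
move=> e0; have iP := integrable_poisson_kernel R e x e0.
have E : (fun u => (poisson_kernel R e x u * cst c u)%:E) =
    (fun u => c%:E * (poisson_kernel R e x u)%:E)%E.
  by apply/funext => u; rewrite EFinM muleC.
rewrite /has_poisson_average E; split; first by have := integrableZl measurableT c iP.
by rewrite integralZl// integral_poisson_kernel// mule1.
Qed.

Lemma poisson_averageD (R : realType) (e x : R) (f g : R -> R) (v w : R) :
  has_poisson_average R e x f v -> has_poisson_average R e x g w ->
  has_poisson_average R e x (fun u => f u + g u) (v + w).
Proof.
move=> [fi fv] [gi gw].
have E : (fun u => (poisson_kernel R e x u * (f u + g u))%:E) =
  (fun u => (poisson_kernel R e x u * f u)%:E + (poisson_kernel R e x u * g u)%:E)%E.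
  by apply/funext => u; rewrite -EFinD mulrDr.
rewrite /has_poisson_average E; split; first exact: integrableD.
by rewrite integralD_EFin// fv gw.
Qed.

Lemma poisson_averageZ (R : realType) (e x c : R) (f : R -> R) (v : R) :
  has_poisson_average R e x f v ->
  has_poisson_average R e x (fun u => c * f u) (c * v).
Proof.
move=> [fi fv].
have E : (fun u => (poisson_kernel R e x u * (c * f u))%:E) =
  (fun u => c%:E * (poisson_kernel R e x u * f u)%:E)%E.
  by apply/funext => u; rewrite -EFinM mulrCA.
rewrite /has_poisson_average E; split; first by have := integrableZl measurableT c fi.
by rewrite integralZl// fv.
Qed.

Lemma poisson_average_sum (R : realType) (e x : R) (q : nat)
    (f : 'I_q -> R -> R) (v : 'I_q -> R) : 0 < e ->
  (forall j, has_poisson_average R e x (f j) (v j)) ->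
  has_poisson_average R e x (fun u => \sum_(j < q) f j u) (\sum_(j < q) v j).
Proof.
move=> e0; elim: q f v => [|q IH] f v H.
  rewrite big_ord0; under eq_fun do rewrite big_ord0.
  exact: poisson_average_cst.
rewrite big_ord_recl; under eq_fun do rewrite big_ord_recl.
apply: poisson_averageD; first exact: H.
by apply: (IH (fun j => f (lift ord0 j)) (fun j => v (lift ord0 j))) => j; exact: H.
Qed.

(** The squared distance from u + i h to a - i d is (u - a) ^+ 2 + (d + h) ^+ 2,
    and its logarithm is harmonic for h > 0 since the pole lies below the real
    line. *)
Lemma poisson_average_ln (R : realType) (e x a d : R) : 0 < e -> 0 < d ->
  has_poisson_average R e x (fun u => ln ((u - a) ^+ 2 + d ^+ 2))
    (ln ((x - a) ^+ 2 + (d + e) ^+ 2)).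
Proof.
move=> e0 d0; have dn0 : d != 0 by rewrite gt_eqF.
have key : has_poisson_average R e x
    (fun u => ln ((u - a) ^+ 2 + d ^+ 2) - ln (d ^+ 2))
    (ln ((x - a) ^+ 2 + (d + e) ^+ 2) - ln (d ^+ 2)).
  split; last exact: integral_poisson_kernel_ln_incr.
  apply/integrableP; split.
    apply/measurable_EFinP; apply: measurable_funM.
      by apply: continuous_measurable_fun; exact: continuous_poisson_kernel.
    apply: measurable_funB => //; apply: measurableT_comp; first exact: measurable_ln.
    by apply: measurable_funD => //; apply: measurable_funX; exact: measurable_funB.
  under eq_integral.
    move=> u _; rewrite /= ger0_norm; last first.
      apply: mulr_ge0; first exact/ltW/poisson_kernel_gt0.
      by rewrite subr_ge0 ler_ln ?posrE ?exprn_gt0 ?sqrD_sqr_gt0// lerDr sqr_ge0.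
    over.
  by rewrite integral_poisson_kernel_ln_incr// ltry.
have := poisson_averageD _ _ _ _ _ _ _ key (poisson_average_cst R e x (ln (d ^+ 2)) e0).
by under eq_fun do rewrite subrK; rewrite subrK.
Qed.

(** Harmonic extension of the field to height h.  On the real line a charge and its
    complex conjugate have the same potential, so all charges are placed in the
    lower half-plane, away from x + i h. *)
Definition charge_field_above (R : realType) (q : nat) (gamma : 'I_q -> R)
    (z : 'I_q -> R[i]) (h x : R) : R :=
  \sum_(j < q) gamma j * (2^-1 *
    ln ((x - complex.Re (z j)) ^+ 2 + (`|complex.Im (z j)| + h) ^+ 2)).

Lemma point_charge_fieldE (R : realType) (q : nat) (gamma : 'I_q -> R)
    (z : 'I_q -> R[i]) (x : R) : (forall j, complex.Im (z j) != 0) ->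
  point_charge_field gamma z x = charge_field_above R q gamma z 0 x.
Proof.
move=> hz; apply: eq_bigr => j _; congr (_ * _).
rewrite addr0 real_normK ?num_real//; have := hz j.
case: (z j) => a b /= b0; rewrite sub0r sqrrN.
set s := _ + _; have s0 : 0 < s by exact: sqrD_sqr_gt0.
rewrite -[in RHS](sqr_sqrtr (ltW s0)) lnXn ?sqrtr_gt0//.
by generalize (ln (Num.sqrt s)) => l; lra.
Qed.

Lemma poisson_average_charge_field (R : realType) (q : nat) (gamma : 'I_q -> R)
    (z : 'I_q -> R[i]) (e x : R) : (forall j, complex.Im (z j) != 0) -> 0 < e ->
  has_poisson_average R e x (point_charge_field gamma z)
    (charge_field_above R q gamma z e x).
Proof.
move=> hz e0; rewrite (_ : point_charge_field gamma z = charge_field_above R q gamma z 0).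
  apply: poisson_average_sum => // j; do 2 apply: poisson_averageZ.
  by rewrite addr0; apply: poisson_average_ln => //; rewrite normr_gt0.
by apply/funext => u; rewrite point_charge_fieldE.
Qed.

(** * Poisson averages of the energy kernel *)

(** The constant C serves to make the kernel nonnegative, so that iterated
    integrals can be exchanged freely. *)
Definition shifted_kernel (R : realType) (C : R) (Q : R -> R) (T x y : R) : \bar R :=
  (C%:E + energy_kernel Q T x y)%E.

(** The distance |x - y| is replaced by |x + i d - y|.  These finite kernels increase
    to the singular one as d decreases to 0, including on the diagonal. *)
Definition regularized_kernel (R : realType) (C : R) (Q : R -> R) (T d x y : R) : R :=
  C - 2^-1 * ln ((x - y) ^+ 2 + d ^+ 2) + (Q x / T + Q y / T).

Lemma shifted_kernelC (R : realType) (C : R) (Q : R -> R) (T x y : R) :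
  shifted_kernel R C Q T x y = shifted_kernel R C Q T y x.
Proof. by rewrite /shifted_kernel /energy_kernel distrC addeAC. Qed.

Lemma cvg_log_kernel (R : realType) (r : R) :
  (- (2^-1 * ln (r ^+ 2 + harmonic n ^+ 2)))%:E @[n --> \oo] -->
    lne (`|r|%:E)^-1%E.
Proof.
have [->|r0] := eqVneq r 0.
  rewrite normr0 inve0 /=; apply/cvgeryP/cvgryPge => A; near=> n.
  rewrite expr0n/= add0r lnXn ?harmonic_gt0// /harmonic lnV ?posrE//.
  have -> : - (2^-1 * (- ln n.+1%:R *+ 2)) = ln n.+1%:R :> R.
    by generalize (ln (n.+1%:R : R)) => l; lra.
  rewrite -ler_expR lnK ?posrE// (@le_trans _ _ n%:R) ?ler_nat//.
  by near: n; exact: nbhs_infty_ger.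
rewrite inver normr_eq0 (negbTE r0) lne_EFin ?invr_gt0 ?normr_gt0//.
rewrite lnV ?posrE ?normr_gt0//.
have rE : ln `|r| = 2^-1 * ln (r ^+ 2).
  rewrite -(real_normK (num_real r)) lnXn ?normr_gt0//.
  by move: (ln _) => l; lra.
have hr : (fun n => r ^+ 2 + harmonic n ^+ 2) n @[n --> \oo] --> r ^+ 2.
  have h2 : (fun n => harmonic n * harmonic n) n @[n --> \oo] --> (0 : R).
    by rewrite -[X in _ --> X](mulr0 0); apply: cvgM; exact: cvg_harmonic.
  by rewrite -[X in _ --> X]addr0; apply: cvgD; [exact: cvg_cst|exact: h2].
rewrite [X in _ --> X](_ : _ = (- (2^-1 * ln (r ^+ 2)))%:E); last first.
  by congr (- _)%:E; exact: rE.
apply: cvg_EFin; first exact: nearW.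
apply: cvgN; apply: cvgM; first exact: cvg_cst.
apply: (cvg_comp _ (@ln R) hr).
by apply: continuous_ln; rewrite exprn_even_gt0.
Unshelve. all: by end_near. Qed.

Lemma cvg_regularized_kernel (R : realType) (C : R) (Q : R -> R) (T x y : R) :
  (regularized_kernel R C Q T (harmonic n) x y)%:E @[n --> \oo] -->
    shifted_kernel R C Q T x y.
Proof.
have -> : shifted_kernel R C Q T x y =
    ((C + (Q x / T + Q y / T))%:E + lne (`|x - y|%:E)^-1)%E.
  rewrite /shifted_kernel /energy_kernel !EFinD.
  by rewrite [RHS]addeC [RHS]addeCA; congr (_ + _)%E; exact/esym/addeA.
have E n : (regularized_kernel R C Q T (harmonic n) x y)%:E =
   ((C + (Q x / T + Q y / T))%:E +
      (- (2^-1 * ln ((x - y) ^+ 2 + harmonic n ^+ 2)))%:E)%E.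
  by rewrite -EFinD /regularized_kernel; congr EFin; ring.
under eq_cvg do rewrite E.
apply: cvgeD; last exact: cvg_log_kernel.
- exact: fin_num_adde_defr.
- exact: cvg_cst.
Qed.

Lemma nonincreasing_regularized_kernel (R : realType) (C : R) (Q : R -> R)
    (T x y d d' : R) : 0 < d -> d <= d' ->
  regularized_kernel R C Q T d' x y <= regularized_kernel R C Q T d x y.
Proof.
move=> d0 dd'; have d'0 := lt_le_trans d0 dd'.
rewrite lerD2r lerD2l lerN2 ler_pM2l ?invr_gt0//.
rewrite ler_ln ?posrE ?sqrD_sqr_gt0 ?gt_eqF// lerD2l.
by rewrite ler_pXn2r// nnegrE ltW.
Qed.

Lemma harmonic_le1 (R : realType) (n : nat) : harmonic n <= 1 :> R.
Proof. by rewrite /harmonic invf_le1// ler1n. Qed.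

(** (x - y) ^+ 2 <= (1 + x ^+ 2) * (1 + y ^+ 2): the chordal distance is at most one.
    Hence a bound on Q / T - ln (1 + t ^+ 2) / 2 bounds the kernel from below; the
    summand 1 in the constant absorbs d <= 1. *)
Lemma regularized_kernel_ge0 (R : realType) (Q : R -> R) (T M d x y : R) :
  (forall t, `|Q t / T - 2^-1 * ln (1 + t ^+ 2)| <= M) -> 0 < d -> d <= 1 ->
  0 <= regularized_kernel R (2 * M + 1) Q T d x y.
Proof.
move=> hM d0 d1; have := hM x; have := hM y.
rewrite !ler_norml => /andP[hy _] /andP[hx _].
have sq0 t : 0 < 1 + t ^+ 2 :> R by rewrite ltr_pwDl// sqr_ge0.
have : ln ((x - y) ^+ 2 + d ^+ 2) <= ln 2 + (ln (1 + x ^+ 2) + ln (1 + y ^+ 2)).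
  rewrite -!lnM ?posrE ?mulr_gt0//.
  rewrite ler_ln ?posrE ?mulr_gt0 ?sqrD_sqr_gt0 ?gt_eqF//.
  have d2 : d ^+ 2 <= 1 by rewrite expr_le1// ltW.
  have := sqr_ge0 (1 + x * y); have := sqr_ge0 (x + y).
  have := sqr_ge0 (x * y); move: d2; rewrite !expr2; nra.
have : ln 2 <= 1 :> R.
  by have := @le_ln1Dx R 1; rewrite (_ : 1 + 1 = 2 :> R)//; apply; lra.
by rewrite /regularized_kernel; lra.
Qed.

Lemma measurable_regularized_kernel (R : realType) (C : R) (Q : R -> R) (T d : R) :
  measurable_fun [set: R] Q ->
  measurable_fun [set: measurableTypeR R * measurableTypeR R]
    (fun z => (regularized_kernel R C Q T d z.1 z.2)%:E).
Proof.
move=> mQ; apply/measurable_EFinP; apply: measurable_funD.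
  apply: measurable_funB => //; apply: measurable_funM => //.
  apply: measurableT_comp; first exact: measurable_ln.
  apply: measurable_funD => //; apply: measurable_funX.
  by apply: measurable_funB; [exact: measurable_fst|exact: measurable_snd].
apply: measurable_funD; apply: measurable_funM => //.
  by apply: measurableT_comp => //; exact: measurable_fst.
by apply: measurableT_comp => //; exact: measurable_snd.
Qed.

Lemma measurable_shifted_kernel (R : realType) (C : R) (Q : R -> R) (T : R) :
  measurable_fun [set: R] Q ->
  measurable_fun [set: measurableTypeR R * measurableTypeR R]
    (fun z => shifted_kernel R C Q T z.1 z.2).
Proof.
move=> mQ; apply: (emeasurable_fun_cvg
  (fun n z => (regularized_kernel R C Q T (harmonic n) z.1 z.2)%:E)).
- by move=> n; exact: measurable_regularized_kernel.
- by move=> z _; exact: cvg_regularized_kernel.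
Qed.

Lemma shifted_kernel_ge_regularized (R : realType) (C : R) (Q : R -> R) (T d x y : R) :
  0 < d -> ((regularized_kernel R C Q T d x y)%:E <= shifted_kernel R C Q T x y)%E.
Proof.
move=> d0; have cK := cvg_regularized_kernel R C Q T x y.
have <- := cvg_lim (@ereal_hausdorff R) cK.
apply: lime_ge; first by apply/cvg_ex; eexists; exact: cK.
near=> n; rewrite lee_fin nonincreasing_regularized_kernel ?harmonic_gt0//.
near: n.
have /cvgrPdist_le/(_ _ d0) := @cvg_harmonic R.
by apply: filterS => n; rewrite sub0r normrN ger0_norm ?harmonic_ge0.
Unshelve. all: by end_near. Qed.

Lemma shifted_kernel_ge0 (R : realType) (Q : R -> R) (T M x y : R) :
  (forall t, `|Q t / T - 2^-1 * ln (1 + t ^+ 2)| <= M) ->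
  (0 <= shifted_kernel R (2 * M + 1) Q T x y)%E.
Proof.
move=> hM; apply: le_trans (shifted_kernel_ge_regularized _ _ _ _ 1 _ _ ltr01).
by rewrite lee_fin; exact: regularized_kernel_ge0.
Qed.

Lemma poisson_average_regularized_kernel (R : realType) (C : R) (Q : R -> R)
    (T d e x s v : R) : 0 < d -> 0 < e -> has_poisson_average R e x Q v ->
  has_poisson_average R e x (fun u => regularized_kernel R C Q T d u s)
    (C - 2^-1 * ln ((x - s) ^+ 2 + (d + e) ^+ 2) + (v / T + Q s / T)).
Proof.
move=> d0 e0 hQ; apply: poisson_averageD.
  apply: poisson_averageD; first exact: poisson_average_cst.
  rewrite -mulNr; under eq_fun do rewrite -mulNr.
  by apply: poisson_averageZ; exact: poisson_average_ln.
apply: poisson_averageD; last exact: poisson_average_cst.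
by rewrite mulrC; under eq_fun do rewrite mulrC; exact: poisson_averageZ.
Qed.

(** Averaging replaces |x - s| by the larger distance |x + i e - s| and Q x by the
    value v of its harmonic extension.  The singular kernel is reached from the
    regularized ones by monotone convergence. *)
Lemma integral_poisson_shifted_kernel_le (R : realType) (Q : R -> R)
    (T M e x s v : R) : measurable_fun [set: R] Q ->
  (forall t, `|Q t / T - 2^-1 * ln (1 + t ^+ 2)| <= M) -> 0 < e ->
  has_poisson_average R e x Q v ->
  (\int[lebesgue_measure]_u
     ((poisson_kernel R e x u)%:E * shifted_kernel R (2 * M + 1) Q T u s)
   <= (regularized_kernel R (2 * M + 1) Q T e x s - (Q x - v) / T)%:E)%E.
Proof.
move=> mQ hM e0 hQ; set C := 2 * M + 1.
pose g n u := (poisson_kernel R e x u * regularized_kernel R C Q T (harmonic n) u s)%:E.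
have P0 u := poisson_kernel_gt0 R e x u e0.
have mP : measurable_fun [set: R] (poisson_kernel R e x).
  by apply: continuous_measurable_fun; exact: continuous_poisson_kernel.
have g_cvg u : g n u @[n --> \oo] -->
    ((poisson_kernel R e x u)%:E * shifted_kernel R C Q T u s)%E.
  have Pfin : (poisson_kernel R e x u)%:E \is a fin_num by [].
  exact: cvgeZl Pfin (cvg_regularized_kernel R C Q T u s).
have mg n : measurable_fun [set: R] (g n).
  apply/measurable_EFinP; apply: measurable_funM => //.
  have /measurable_EFinP mK := measurable_regularized_kernel R C Q T (harmonic n) mQ.
  exact: measurableT_comp mK (pair2_measurable (s : measurableTypeR R)).
have g0 n u : (0 <= g n u)%E.
  rewrite lee_fin mulr_ge0 ?(ltW (P0 u))//.
  by rewrite regularized_kernel_ge0 ?harmonic_gt0 ?harmonic_le1.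
have ndg u : {homo (fun n => g n u) : n m / (n <= m)%N >-> (n <= m)%E}.
  move=> n m nm; rewrite lee_fin ler_pM2l//.
  apply: nonincreasing_regularized_kernel; first exact: harmonic_gt0.
  by rewrite /harmonic lef_pV2 ?posrE// ler_nat ltnS.
have -> : (\int[lebesgue_measure]_u
     ((poisson_kernel R e x u)%:E * shifted_kernel R C Q T u s)
     = limn (fun n => \int[lebesgue_measure]_u g n u))%E.
  rewrite -monotone_convergence//.
  by apply: eq_integral => u _; apply/esym/cvg_lim.
apply: lime_le.
  apply: ereal_nondecreasing_is_cvgn => n m nm.
  apply: ge0_le_integral => //; [exact: mg|exact: mg|].
  by move=> u _; exact: ndg.
apply: nearW => n; rewrite /g.
have [_ ->] := poisson_average_regularized_kernel R C Q T _ e x s v (harmonic_gt0 n) e0 hQ.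
rewrite lee_fin /regularized_kernel.
have -> : C - 2^-1 * ln ((x - s) ^+ 2 + e ^+ 2) + (Q x / T + Q s / T) - (Q x - v) / T
  = C - 2^-1 * ln ((x - s) ^+ 2 + e ^+ 2) + (v / T + Q s / T) by ring.
rewrite lerD2r lerD2l lerN2 ler_pM2l ?invr_gt0//.
have h0 := harmonic_gt0 (R := R) n.
rewrite ler_ln ?posrE ?sqrD_sqr_gt0 ?gt_eqF ?addr_gt0// lerD2l.
by rewrite ler_pXn2r ?nnegrE ?lerDr ?addr_ge0// ltW.
Qed.

(** * Densities and sweeping of finite measures *)

(** An alias on which the finiteness of m, here a hypothesis, can be registered as
    part of a structure. *)
Definition finite_copy d (T : measurableType d) (R : realType)
  (m : {measure set T -> \bar R}) (moo : (m setT < +oo)%E) : set T -> \bar R := m.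

HB.instance Definition _ d (T : measurableType d) (R : realType)
  (m : {measure set T -> \bar R}) (moo : (m setT < +oo)%E) :=
  Measure.copy (finite_copy d T R m moo) m.

HB.instance Definition _ d (T : measurableType d) (R : realType)
  (m : {measure set T -> \bar R}) (moo : (m setT < +oo)%E) :=
  Measure_isFinite.Build d T R (finite_copy d T R m moo)
    (@lty_fin_num_fun d T R m moo).

Lemma ex_finite_measure d (T : measurableType d) (R : realType)
    (m : {measure set T -> \bar R}) : (m setT < +oo)%E ->
  exists m' : {finite_measure set T -> \bar R}, forall A, m' A = m A.
Proof. by move=> moo; exists (finite_copy d T R m moo). Qed.

Lemma density_sigma_additive d (T : measurableType d) (R : realType)
    (m : {measure set T -> \bar R}) (g : T -> \bar R) :
  measurable_fun setT g -> (forall x, 0 <= g x)%E ->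
  semi_sigma_additive (fun A => \int[m]_(x in A) g x)%E.
Proof.
move=> mg g0 F mF tF mUF; rewrite ge0_integral_bigcup//; last first.
  exact: measurable_funTS.
apply: is_cvg_ereal_nneg_natsum_cond => n _ _.
by apply: integral_ge0 => x _; exact: g0.
Qed.

Section density.
Import HBNNSimple.

Lemma ex_density_measure d (T : measurableType d) (R : realType)
    (m : {measure set T -> \bar R}) (g : T -> R) :
  measurable_fun setT g -> (forall x, 0 <= g x) ->
  (\int[m]_x (g x)%:E < +oo)%E ->
  exists nu : {finite_measure set T -> \bar R},
    forall f : T -> \bar R, measurable_fun setT f -> (forall x, 0 <= f x)%E ->
    (\int[nu]_x f x = \int[m]_x ((g x)%:E * f x))%E.
Proof.
move=> mg g0 goo.
have mge : measurable_fun setT (EFin \o g) by exact/measurable_EFinP.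
have ge0 x : (0 <= (EFin \o g) x)%E by rewrite lee_fin.
pose n0 (A : set T) := (\int[m]_(x in A) (g x)%:E)%E.
have n00 : n0 set0 = 0%E by rewrite /n0 integral_set0.
have n0ge A : (0 <= n0 A)%E by apply: integral_ge0 => x _; exact: ge0.
have n0sa : semi_sigma_additive n0 := density_sigma_additive _ _ _ m _ mge ge0.
pose nu0 : {measure set T -> \bar R} :=
  HB.pack n0 (isMeasure.Build _ T R n0 n00 n0ge n0sa).
have [|nu nuE] := ex_finite_measure _ _ _ nu0; first exact: goo.
exists nu => f mf f0.
rewrite [LHS](eq_measure_integral nu0); last by move=> A _ _; exact: nuE.
pose h := nnsfun_approx measurableT mf.
have hf x : (h n x)%:E @[n --> \oo] --> f x by apply: cvg_nnsfun_approx.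
have ndh x : {homo (fun n => h n x) : a b / (a <= b)%N >-> a <= b}.
  by move=> a b ab; exact/lefP/nd_nnsfun_approx.
have mh n : measurable_fun setT (fun x => (h n x)%:E) by exact/measurable_EFinP.
have mgM (k : T -> \bar R) : measurable_fun setT k ->
    measurable_fun setT (fun x => (g x)%:E * k x)%E.
  by move=> mk; exact: emeasurable_funM mge mk.
have simple n : (\int[nu0]_x (h n x)%:E = \int[m]_x ((g x)%:E * (h n x)%:E))%E.
  have mA r : measurable (h n @^-1` [set r]) by [].
  under eq_integral do rewrite fimfunE -fsumEFin//.
  rewrite ge0_integral_fsum//; last 2 first.
  - by move=> r; exact/measurable_EFinP/measurableT_comp.
  - by move=> r x _; rewrite EFinM nnfun_muleindic_ge0.
  under [RHS]eq_integral.
    move=> x _; rewrite fimfunE -fsumEFin// ge0_mule_fsumr; last first.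
      by move=> r; rewrite EFinM nnfun_muleindic_ge0.
    over.
  rewrite [RHS]ge0_integral_fsum//; last 2 first.
  - by move=> r; apply: mgM; apply/measurable_EFinP/measurableT_comp.
  - move=> r x _; apply: mule_ge0; first by rewrite lee_fin.
    by rewrite EFinM nnfun_muleindic_ge0.
  apply: eq_fsbigr => r; rewrite inE => -[y _ <-].
  rewrite integralZl_indic_nnsfun// integral_indic// setIT.
  under [RHS]eq_integral do rewrite EFinM muleCA.
  rewrite ge0_integralZl//; last 3 first.
  - by apply: mgM; apply/measurable_EFinP; exact: measurable_indic.
  - by move=> x _; apply: mule_ge0; rewrite lee_fin.
  - by rewrite lee_fin.
  congr (_ * _)%E; rewrite /= /n0 [LHS]integral_mkcond.
  apply: eq_integral => x _; rewrite patchE indicE.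
  by case: ifPn => _; rewrite ?mule1 ?mule0.
transitivity (limn (fun n => \int[nu0]_x (h n x)%:E)%E).
  rewrite -monotone_convergence//.
  - by apply: eq_integral => x _; apply/esym/cvg_lim.
  - by move=> n x _; rewrite lee_fin.
  - by move=> x _ a b ab; rewrite lee_fin; exact: ndh.
under eq_fun do rewrite simple.
rewrite -monotone_convergence//.
- by apply: eq_integral => x _; apply/cvg_lim => //; exact: cvgeZl.
- by move=> n; exact: mgM.
- by move=> n x _; rewrite mule_ge0// lee_fin.
- by move=> x _ a b ab; rewrite lee_pmul// lee_fin//; exact: ndh.
Qed.

End density.

Lemma ex_sum_measure d (T : measurableType d) (R : realType)
    (m1 m2 : {finite_measure set T -> \bar R}) :
  exists nu : {finite_measure set T -> \bar R},
    forall f : T -> \bar R, measurable_fun setT f -> (forall x, 0 <= f x)%E ->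
    (\int[nu]_x f x = \int[m1]_x f x + \int[m2]_x f x)%E.
Proof.
have [|nu nuE] := ex_finite_measure _ _ _ (measure_add m1 m2).
  rewrite -[X in (X < _)%E]/(measure_add m1 m2 setT) measure_addE.
  by rewrite lte_add_pinfty// -ge0_fin_numE ?fin_num_measure.
exists nu => f mf f0; rewrite (eq_measure_integral (measure_add m1 m2)).
  by rewrite ge0_integral_measure_add.
by move=> A _ _; exact: nuE.
Qed.

(** Each unit mass at a point x of B is spread out with density
    poisson_kernel R e x, the balayage onto the real line of a unit mass at
    x + i e; the rest of mu is left in place. *)
Lemma ex_swept_measure (R : realType)
    (mu : {finite_measure set (measurableTypeR R) -> \bar R})
    (B : set (measurableTypeR R)) (e : R) : measurable B -> 0 < e ->
  exists nu : {finite_measure set (measurableTypeR R) -> \bar R},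
    forall f : measurableTypeR R -> \bar R,
    measurable_fun setT f -> (forall x, 0 <= f x)%E ->
    let swept x := (if x \in B then
      \int[lebesgue_measure]_u ((poisson_kernel R e x u)%:E * f u) else f x)%E in
    measurable_fun setT swept /\ (\int[nu]_x f x = \int[mu]_x swept x)%E.
Proof.
move=> mB e0.
have P0 x u := ltW (poisson_kernel_gt0 R e x u e0).
have mP : measurable_fun [set: measurableTypeR R * measurableTypeR R]
    (fun z => poisson_kernel R e z.1 z.2).
  apply: measurable_funM => //; apply: measurable_funV_gt0.
    apply: measurable_funM => //; apply: measurable_funD => //.
    by apply: measurable_funX; apply: measurable_funB.
  by move=> z; rewrite mulr_gt0 ?pi_gt0// sqrD_sqr_gt0// gt_eqF.
pose w (x u : R) := poisson_kernel R e x u * \1_B x.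
have w0 x u : 0 <= w x u by rewrite mulr_ge0.
have mw : measurable_fun [set: measurableTypeR R * measurableTypeR R]
    (fun z => (w z.1 z.2)%:E).
  apply/measurable_EFinP; apply: measurable_funM => //.
  by apply: measurableT_comp; [exact: measurable_indic|exact: measurable_fst].
have we0 (z : measurableTypeR R * measurableTypeR R) : (0 <= (w z.1 z.2)%:E)%E.
  by rewrite lee_fin.
have Pub x u : w x u <= (pi * e)^-1.
  rewrite /w indicE; case: (x \in B); last by rewrite mulr0 invr_ge0 mulr_ge0 ?pi_ge0 ?ltW.
  rewrite mulr1 ler_pdivrMr ?mulr_gt0 ?pi_gt0 ?sqrD_sqr_gt0 ?gt_eqF//.
  rewrite invfM mulrACA mulVf ?gt_eqF ?pi_gt0// mul1r ler_pdivlMl//.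
  by rewrite -expr2 lerDr sqr_ge0.
pose G u := (\int[mu]_x (w x u)%:E)%E.
have Gfin u : G u \is a fin_num.
  rewrite ge0_fin_numE; last by apply: integral_ge0 => x _; rewrite lee_fin.
  apply: (@le_lt_trans _ _ (\int[mu]_x ((pi * e)^-1%:E))%E).
    apply: ge0_le_integral => //.
    - by move=> x _; rewrite lee_fin.
    - exact: measurableT_comp mw (pair2_measurable (u : measurableTypeR R)).
    - by move=> x _; rewrite lee_fin.
  rewrite integral_cst// lte_mul_pinfty ?lee_fin ?invr_ge0 ?mulr_ge0 ?pi_ge0 ?ltW//.
  by rewrite -ge0_fin_numE ?fin_num_measure.
have mG : measurable_fun setT G.
  exact: (measurable_fun_fubini_tonelli_G (m1 := mu) _ mw we0).
pose g u := fine (G u).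
have gE u : (g u)%:E = G u by rewrite fineK.
have mg : measurable_fun setT g.
  by apply/measurable_EFinP; rewrite (_ : EFin \o g = G)//; apply/funext.
have g0 u : 0 <= g u.
  by apply: fine_ge0; apply: integral_ge0 => x _; rewrite lee_fin.
have swap (f : measurableTypeR R -> \bar R) : measurable_fun setT f ->
    (forall x, 0 <= f x)%E ->
    measurable_fun setT (fun x => \int[lebesgue_measure]_u ((w x u)%:E * f u))%E /\
    (\int[lebesgue_measure]_u ((g u)%:E * f u) =
     \int[mu]_x \int[lebesgue_measure]_u ((w x u)%:E * f u))%E.
  move=> mf f0; pose k (z : measurableTypeR R * measurableTypeR R) :=
    ((w z.1 z.2)%:E * f z.2)%E.
  have mk : measurable_fun setT k.
    by apply: emeasurable_funM mw _; apply: measurableT_comp mf _.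
  have k0 z : (0 <= k z)%E by apply: mule_ge0.
  split; first exact: (measurable_fun_fubini_tonelli_F (m2 := lebesgue_measure) _ mk k0).
  have := @fubini_tonelli _ _ _ _ R mu lebesgue_measure _ mk k0.
  move=> ->; apply: eq_integral => u _; rewrite gE -ge0_integralZr//.
  - exact: measurableT_comp mw (pair2_measurable (u : measurableTypeR R)).
  - by move=> x _; rewrite lee_fin.
have [|tau tauE] := ex_density_measure _ _ _ lebesgue_measure g mg g0.
  under eq_integral do rewrite -[(g _)%:E]mule1.
  have [_ ->] := swap (cst 1%E) (measurable_cst _) (fun=> lee01).
  apply: (@le_lt_trans _ _ (\int[mu]_x 1%E)%E).
    apply: ge0_le_integral => //.
    - by move=> x _; apply: integral_ge0 => u _; rewrite mule_ge0// lee_fin.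
    - by have [] := swap (cst 1%E) (measurable_cst _) (fun=> lee01).
    - move=> x _; under eq_integral do rewrite mule1 /w.
      rewrite indicE; case: (x \in B).
        by under eq_integral do rewrite mulr1; rewrite integral_poisson_kernel.
      by under eq_integral do rewrite mulr0; rewrite integral0.
  by rewrite integral_cst// mul1e -ge0_fin_numE ?fin_num_measure.
have m1 : measurable_fun setT (\1_(~` B) : measurableTypeR R -> R).
  by apply: measurable_indic; exact: measurableC.
have i1 : (\int[mu]_x (\1_(~` B) x : R)%:E < +oo)%E.
  rewrite integral_indic ?setIT//; last exact: measurableC.
  by rewrite -ge0_fin_numE ?fin_num_measure//; exact: measurableC.
have p1 (x : measurableTypeR R) : 0 <= \1_(~` B) x :> R by [].
have [rho rhoE] := ex_density_measure _ _ _ mu _ m1 p1 i1.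
have [nu nuE] := ex_sum_measure _ _ _ rho tau.
exists nu => f mf f0 swept; have [mS swapE] := swap f mf f0.
have m1f : measurable_fun setT (fun x => (\1_(~` B) x)%:E * f x)%E.
  by apply: emeasurable_funM mf; exact/measurable_EFinP.
have sweptE : swept = (fun x => (\1_(~` B) x)%:E * f x +
    \int[lebesgue_measure]_u ((w x u)%:E * f u))%E.
  apply/funext => x; rewrite /swept /w !indicE in_setC; case: (x \in B) => /=.
    by rewrite mul0e add0e; apply: eq_integral => u _; rewrite mulr1.
  by rewrite mul1e integral0_eq ?adde0// => u _; rewrite mulr0 mul0e.
rewrite sweptE; split; first exact: emeasurable_funD.
rewrite nuE// rhoE// tauE// swapE -ge0_integralD//.
- by move=> x _; rewrite mule_ge0// lee_fin.
- by move=> x _; apply: integral_ge0 => u _; rewrite mule_ge0// lee_fin.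
Qed.

(** * Comparison of energies *)

(** The integral of f may be +oo, but its negative part is at most c, so adding
    that part to both sides leaves only nonnegative functions. *)
Lemma ge0_integral_cstD d (T : measurableType d) (R : realType)
    (m : {finite_measure set T -> \bar R}) (c : R) (f : T -> \bar R) :
  measurable_fun setT f -> 0 <= c -> (forall x, 0 <= c%:E + f x)%E ->
  (\int[m]_x (c%:E + f x) = c%:E * m setT + \int[m]_x f x)%E.
Proof.
move=> mf c0 cf0.
have mT : m setT \is a fin_num by rewrite fin_num_measure.
have negc x : (f^\- x <= c%:E)%E.
  rewrite funenegE ge_max lee_fin c0 andbT; have := cf0 x.
  by case: (f x) => [r| |] //=; rewrite -?EFinD ?lee_fin ?leNye//; lra.
have neg0 : (\int[m]_x f^\- x)%E \is a fin_num.
  rewrite ge0_fin_numE; last by apply: integral_ge0.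
  apply: (@le_lt_trans _ _ (\int[m]_x c%:E)%E).
    by apply: ge0_le_integral => //; exact: measurable_funeneg.
  by rewrite integral_cst// ltey_eq fin_numM.
have E x : (c%:E + f x + f^\- x = c%:E + f^\+ x)%E.
  rewrite funenegE funeposE; have := cf0 x; case: (f x) => [r| |] //= _; last first.
    by rewrite maxNye maxye// adde0.
  rewrite -!EFin_max -!EFinD; congr EFin.
  case: (leP r 0) => r0.
    have /max_idPl -> : 0 <= - r by lra.
    by rewrite addrK addr0.
  have /max_idPr -> : - r <= 0 by lra.
  by rewrite addr0.
have mfn : measurable_fun setT (f^\-)%E by exact: measurable_funeneg.
have mfp : measurable_fun setT (f^\+)%E by exact: measurable_funepos.
have := ge0_integralD m measurableT (fun x _ => cf0 x)
  (emeasurable_funD (measurable_cst _) mf)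
  (fun x _ => funeneg_ge0 f x) mfn.
under eq_integral do rewrite E.
rewrite ge0_integralD//.
rewrite integral_cst// => h.
rewrite [X in (_ = _ + X)%E]integralE addeA h addeK//.
Qed.

(** Reduces minimality of the weighted energy to the same inequality for a
    nonnegative kernel, the two differing by a constant for measures of equal
    mass. *)
Lemma weighted_energyE (R : realType) (Q : R -> R) (T M m : R)
    (sigma : {finite_measure set (measurableTypeR R) -> \bar R}) :
  measurable_fun [set: R] Q ->
  (forall t, `|Q t / T - 2^-1 * ln (1 + t ^+ 2)| <= M) ->
  sigma setT = m%:E ->
  (\int[sigma]_y \int[sigma]_x shifted_kernel R (2 * M + 1) Q T x y =
   ((2 * M + 1) * m * m)%:E + weighted_energy Q T sigma)%E.
Proof.
move=> mQ hM sm; set C := 2 * M + 1.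
have C0 : 0 <= C by have := normr_ge0 (Q 0 / T - 2^-1 * ln (1 + 0 ^+ 2));
  have := hM 0; rewrite /C; lra.
have m0 : 0 <= m by rewrite -lee_fin -sm.
have K0 x y : (0 <= C%:E + energy_kernel Q T x y)%E.
  exact: (shifted_kernel_ge0 _ _ _ _ x y hM).
have mK := measurable_shifted_kernel R C Q T mQ.
have ecK (f : R -> \bar R) c :
    measurable_fun [set: R] (fun x => c%:E + f x)%E -> measurable_fun [set: R] f.
  move=> mf; have -> : f = (fun x => (- c)%:E + (c%:E + f x))%E.
    by apply/funext => x; rewrite addeA -EFinD addNr add0e.
  exact: emeasurable_funD.
have me y : measurable_fun [set: R] (fun x => energy_kernel Q T x y).
  by apply: (ecK _ C); exact: measurableT_comp mK (pair2_measurable (y : measurableTypeR R)).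
have inner y : (\int[sigma]_x shifted_kernel R C Q T x y =
    (C * m)%:E + \int[sigma]_x energy_kernel Q T x y)%E.
  rewrite ge0_integral_cstD//; last exact: me.
  by congr (_ + _)%E; rewrite -[RHS]/(C%:E * m%:E)%E -sm.
under eq_integral do rewrite inner.
rewrite ge0_integral_cstD ?mulr_ge0//.
- by congr (_ + _)%E; rewrite -[RHS]/((C * m)%:E * m%:E)%E -[in RHS]sm.
- apply: (ecK _ (C * m)); under eq_fun do rewrite -inner.
  apply: (measurable_fun_fubini_tonelli_G (m1 := sigma) _ mK).
  by move=> z; exact: K0.
- by move=> y; rewrite -inner; apply: integral_ge0 => x _; exact: K0.
Qed.

(** If replacing mu by nu lowers the potential everywhere by delta, it lowers the
    energy: U^nu <= U^mu - delta is integrated once against nu and, after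
    exchanging the roles of the two measures, once against mu. *)
Lemma energy_le_of_potential_le (R : realType) (K : R -> R -> \bar R) (delta : R)
    (mu nu : {finite_measure set (measurableTypeR R) -> \bar R}) :
  measurable_fun [set: measurableTypeR R * measurableTypeR R] (fun z => K z.1 z.2) ->
  (forall x y, 0 <= K x y)%E -> (forall x y, K x y = K y x) -> 0 <= delta ->
  (forall y, \int[nu]_x K x y + delta%:E <= \int[mu]_x K x y)%E ->
  (\int[nu]_y \int[nu]_x K x y + delta%:E * mu setT
    <= \int[mu]_y \int[mu]_x K x y)%E.
Proof.
move=> mK K0 KC d0 H.
have K0' (z : measurableTypeR R * measurableTypeR R) : (0 <= K z.1 z.2)%E by exact: K0.
have mU (s : {finite_measure set (measurableTypeR R) -> \bar R}) :
    measurable_fun [set: R] (fun y => \int[s]_x K x y)%E.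
  exact: (measurable_fun_fubini_tonelli_G (m1 := s) _ mK K0').
have U0 (s : {finite_measure set (measurableTypeR R) -> \bar R}) y :
    (0 <= \int[s]_x K x y)%E.
  by apply: integral_ge0 => x _; exact: K0.
have swap : (\int[nu]_y \int[mu]_x K x y = \int[mu]_y \int[nu]_x K x y)%E.
  have <- := @fubini_tonelli _ _ _ _ R mu nu _ mK K0'.
  by apply: eq_integral => y _; apply: eq_integral => x _; rewrite KC.
apply: (@le_trans _ _ (\int[nu]_y \int[mu]_x K x y + delta%:E * mu setT)%E).
  rewrite leeD2r//; apply: ge0_le_integral => //; [exact: mU|exact: mU|].
  by move=> y _; apply: le_trans (H y); rewrite leeDl// lee_fin.
rewrite swap -integral_cst// -ge0_integralD//; last exact: mU.
apply: ge0_le_integral => //; last exact: mU.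
- by move=> y _; rewrite adde_ge0// lee_fin.
- by apply: emeasurable_funD => //; exact: mU.
Qed.

(** T times a Cauchy distribution has finite energy: its potential together with
    the field is bounded above, by the kernel estimate of the averages. *)
Lemma minimal_energy_lt_pinfty (R : realType) (Q : R -> R) (T M v : R)
    (mu : {finite_measure set (measurableTypeR R) -> \bar R}) :
  measurable_fun [set: R] Q ->
  (forall t, `|Q t / T - 2^-1 * ln (1 + t ^+ 2)| <= M) -> 0 < T ->
  has_poisson_average R 1 0 Q v -> energy_minimizer Q T mu ->
  (\int[mu]_y \int[mu]_x shifted_kernel R (2 * M + 1) Q T x y < +oo)%E.
Proof.
move=> mQ hM T0 hQ [muT mumin]; set C := 2 * M + 1.
pose g (u : R) := T * poisson_kernel R 1 0 u.
have g0 u : 0 <= g u by rewrite mulr_ge0 ?ltW// poisson_kernel_gt0.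
have mg : measurable_fun [set: R] g.
  apply: measurable_funM => //; apply: continuous_measurable_fun.
  exact: continuous_poisson_kernel.
have gT : (\int[lebesgue_measure]_u (g u)%:E = T%:E)%E.
  under eq_integral do rewrite EFinM.
  rewrite ge0_integralZl//.
  - by rewrite integral_poisson_kernel// mule1.
  - apply/measurable_EFinP; apply: continuous_measurable_fun.
    exact: continuous_poisson_kernel.
  - by move=> u _; rewrite lee_fin ltW// poisson_kernel_gt0.
  - by rewrite lee_fin ltW.
have goo : (\int[lebesgue_measure]_u (g u)%:E < +oo)%E by rewrite gT ltry.
have [nu nuE] := ex_density_measure _ _ _ lebesgue_measure g mg g0 goo.
have nuT : nu setT = T%:E.
  have := nuE (cst 1%E) (measurable_cst _) (fun=> lee01).
  rewrite integral_cst// mul1e => ->; rewrite -gT.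
  by apply: eq_integral => u _; rewrite mule1.
have K0 x y : (0 <= shifted_kernel R C Q T x y)%E by exact: shifted_kernel_ge0.
have mK := measurable_shifted_kernel R C Q T mQ.
pose D := T * (C + M + v / T).
have UD y : (\int[nu]_x shifted_kernel R C Q T x y <= D%:E)%E.
  rewrite nuE//; last exact: measurableT_comp mK (pair2_measurable (y : measurableTypeR R)).
  rewrite /g; under eq_integral do rewrite EFinM -muleA.
  have Tge : (0 <= T%:E)%E by rewrite lee_fin ltW.
  rewrite ge0_integralZl//.
  - have h := integral_poisson_shifted_kernel_le _ _ _ _ _ _ y _ mQ hM ltr01 hQ.
    apply: le_trans (lee_wpmul2l Tge h) _.
    rewrite -EFinM lee_fin /D ler_pM2l// /regularized_kernel sub0r sqrrN expr1n.
    rewrite [y ^+ 2 + 1]addrC.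
    have := hM y; rewrite ler_norml => /andP[_]; rewrite -/C mulrBl.
    by move: (ln _) (Q y / T) (Q 0 / T) => a b c; lra.
  - apply: emeasurable_funM.
      apply/measurable_EFinP; apply: continuous_measurable_fun.
      exact: continuous_poisson_kernel.
    exact: measurableT_comp mK (pair2_measurable (y : measurableTypeR R)).
  - by move=> u _; rewrite mule_ge0// lee_fin ltW// poisson_kernel_gt0.
rewrite (weighted_energyE _ _ _ _ T mu mQ hM muT).
rewrite lte_add_pinfty ?ltry//; apply: le_lt_trans (mumin nu nuT) _.
have : (\int[nu]_y \int[nu]_x shifted_kernel R C Q T x y < +oo)%E.
  apply: (@le_lt_trans _ _ (\int[nu]_y D%:E)%E).
    apply: ge0_le_integral => //.
    - by move=> y _; apply: integral_ge0 => x _; exact: K0.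
    - apply: (measurable_fun_fubini_tonelli_G (m1 := nu) _ mK).
      by move=> z; exact: K0.
  rewrite integral_cst//; apply: (@le_lt_trans _ _ (D * T)%:E); last exact: ltry.
  by rewrite -[leRHS]/(D%:E * T%:E)%E -[in leRHS]nuT.
rewrite (weighted_energyE _ _ _ _ T nu mQ hM nuT).
by case: (weighted_energy Q T nu) => [r| |] //= _; exact: ltry.
Qed.

(** If B had positive mass, sweeping it to height e and back would lower the
    potential, field included, everywhere by at least eta * mu B: the logarithmic
    part can only decrease, and the field part drops by (Q x - v x) / T for each
    unit of mass at x.  The swept measure would have a smaller energy than the
    minimizer. *)
Lemma minimizer_null_of_field_drop (R : realType) (Q v : R -> R) (T M v0 e eta : R)
    (mu : {finite_measure set (measurableTypeR R) -> \bar R})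
    (B : set (measurableTypeR R)) :
  measurable_fun [set: R] Q ->
  (forall t, `|Q t / T - 2^-1 * ln (1 + t ^+ 2)| <= M) -> 0 < T ->
  has_poisson_average R 1 0 Q v0 ->
  energy_minimizer Q T mu -> measurable B -> 0 < e -> 0 < eta ->
  (forall x, B x -> has_poisson_average R e x Q (v x)) ->
  (forall x, B x -> eta <= (Q x - v x) / T) ->
  mu B = 0%E.
Proof.
move=> mQ hM T0 hQ0 mumin mB e0 eta0 hQ drop; set C := 2 * M + 1.
have Eoo := minimal_energy_lt_pinfty _ _ _ _ _ _ mQ hM T0 hQ0 mumin.
have [muT min] := mumin.
have [nu nuE] := ex_swept_measure _ mu B e mB e0.
have P0 x u := poisson_kernel_gt0 R e x u e0.
have nuT : nu setT = T%:E.
  have [_] := nuE (cst 1%E) (measurable_cst _) (fun=> lee01).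
  rewrite integral_cst// mul1e => ->.
  transitivity (\int[mu]_x 1%E)%E; last by rewrite integral_cst// mul1e.
  apply: eq_integral => x _; case: ifP => // _.
  by under eq_integral do rewrite mule1; exact: integral_poisson_kernel.
have K0 x y : (0 <= shifted_kernel R C Q T x y)%E by exact: shifted_kernel_ge0.
have mK := measurable_shifted_kernel R C Q T mQ.
have mKy y : measurable_fun [set: R] (fun x => shifted_kernel R C Q T x y).
  exact: measurableT_comp mK (pair2_measurable (y : measurableTypeR R)).
have muB : mu B \is a fin_num by rewrite fin_num_measure.
have muB0 : 0 <= fine (mu B) by rewrite fine_ge0.
pose delta := eta * fine (mu B).
have pot y : (\int[nu]_x shifted_kernel R C Q T x y + delta%:E <=
    \int[mu]_x shifted_kernel R C Q T x y)%E.
  have [mS ->] := nuE _ (mKy y) (fun x => K0 x y).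
  have -> : delta%:E = (\int[mu]_x (eta * \1_B x)%:E)%E.
    under eq_integral do rewrite EFinM.
    rewrite ge0_integralZl//.
    - by rewrite integral_indic// setIT /delta EFinM fineK.
    - by apply/measurable_EFinP; exact: measurable_indic.
    - by rewrite lee_fin ltW.
  have S0 x : (0 <= if x \in B then \int[lebesgue_measure]_u
      ((poisson_kernel R e x u)%:E * shifted_kernel R C Q T u y)
      else shifted_kernel R C Q T x y)%E.
    case: ifP => _ //; apply: integral_ge0 => u _.
    by rewrite mule_ge0// lee_fin ltW.
  have m1 : measurable_fun setT (fun x : measurableTypeR R => (eta * \1_B x)%:E).
    by apply/measurable_EFinP; apply: measurable_funM.
  have p1 (x : measurableTypeR R) : (0 <= (eta * \1_B x)%:E)%E.
    by rewrite lee_fin mulr_ge0// ltW.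
  rewrite -ge0_integralD//.
  apply: ge0_le_integral; [by []| |exact: emeasurable_funD|exact: mKy|].
    by move=> x _; exact: adde_ge0.
  move=> x _; rewrite indicE; case: ifPn => xB; last by rewrite mulr0 adde0.
  rewrite inE in xB; rewrite mulr1.
  apply: (@le_trans _ _
    ((regularized_kernel R C Q T e x y - (Q x - v x) / T)%:E + eta%:E)%E).
    rewrite leeD2r//.
    exact: (integral_poisson_shifted_kernel_le _ _ _ _ _ _ _ _ mQ hM e0 (hQ x xB)).
  apply: le_trans (shifted_kernel_ge_regularized _ _ _ _ e _ _ e0).
  by rewrite -EFinD lee_fin; have := drop x xB; lra.
have := energy_le_of_potential_le _ _ delta mu nu mK K0 (shifted_kernelC R C Q T)
  (mulr_ge0 (ltW eta0) muB0) pot.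
have Ege0 : (0 <= \int[mu]_y \int[mu]_x shifted_kernel R C Q T x y)%E.
  by apply: integral_ge0 => y _; apply: integral_ge0 => x _; exact: K0.
move: Eoo Ege0; rewrite -/C.
rewrite (weighted_energyE _ _ _ _ T mu mQ hM muT).
rewrite (weighted_energyE _ _ _ _ T nu mQ hM nuT).
have := min nu nuT; rewrite muT.
case: (weighted_energy Q T mu) => [w| |] //.
case: (weighted_energy Q T nu) => [w'| |] //.
rewrite lee_fin => ww' _ _; rewrite -EFinM -!EFinD lee_fin => h.
have dT : delta * T <= 0 by lra.
have muB_le0 : fine (mu B) <= 0.
  by move: dT; rewrite /delta pmulr_lle0// pmulr_rle0.
by rewrite -(fineK muB); congr EFin; apply/eqP; rewrite eq_le muB_le0 muB0.
Qed.

(** * Asymptotics of fields of point charges *)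

Lemma ln_le_of_le_mul (R : realType) (p r k : R) : 0 < p -> 0 < r -> 0 < k ->
  p <= k * r -> ln p - ln r <= ln k.
Proof.
move=> p0 r0 k0 pkr; rewrite lerBlDr -lnM ?posrE//.
by rewrite ler_ln ?posrE// mulr_gt0.
Qed.

Lemma ln_sqr_shift_bounded (R : realType) (a b : R) : b != 0 ->
  exists L, forall t, `|ln ((t - a) ^+ 2 + b ^+ 2) - ln (1 + t ^+ 2)| <= L.
Proof.
move=> b0; have b2 : 0 < b ^+ 2 by rewrite exprn_even_gt0.
have a2 := sqr_ge0 a.
pose k1 := 2 + 2 * a ^+ 2 + b ^+ 2; pose k2 := 2 + (1 + 2 * a ^+ 2) / b ^+ 2.
have k10 : 0 < k1 by rewrite /k1; lra.
have k20 : 0 < k2.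
  have : 0 <= (1 + 2 * a ^+ 2) / b ^+ 2 by rewrite divr_ge0//; lra.
  by rewrite /k2; lra.
exists (Num.max (ln k1) (ln k2)) => t.
have p0 : 0 < (t - a) ^+ 2 + b ^+ 2 by exact: sqrD_sqr_gt0.
have r0 : 0 < 1 + t ^+ 2 by rewrite ltr_pwDl// sqr_ge0.
have h1 : ln ((t - a) ^+ 2 + b ^+ 2) - ln (1 + t ^+ 2) <= ln k1.
  apply: ln_le_of_le_mul => //; rewrite /k1.
  have := sqr_ge0 (t + a); have := mulr_ge0 a2 (sqr_ge0 t).
  have := mulr_ge0 (ltW b2) (sqr_ge0 t); rewrite !expr2; nra.
have h2 : ln (1 + t ^+ 2) - ln ((t - a) ^+ 2 + b ^+ 2) <= ln k2.
  apply: ln_le_of_le_mul => //.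
  have -> : k2 * ((t - a) ^+ 2 + b ^+ 2) = 2 * (t - a) ^+ 2 + 2 * b ^+ 2 +
      (1 + 2 * a ^+ 2) + (1 + 2 * a ^+ 2) / b ^+ 2 * (t - a) ^+ 2.
    by rewrite /k2; field; exact: b0.
  have : 0 <= (1 + 2 * a ^+ 2) / b ^+ 2 * (t - a) ^+ 2.
    by rewrite mulr_ge0 ?sqr_ge0// divr_ge0//; lra.
  have := sqr_ge0 (t - 2 * a); move: b2; rewrite !expr2; nra.
apply/ler_normlP; split; last by rewrite le_max h1.
by rewrite opprB le_max h2 orbT.
Qed.

(** Since the charges sum to T, the leading terms T ln |t| cancel. *)
Lemma charge_field_weakly_admissible (R : realType) (q : nat)
    (gamma : 'I_q -> R) (z : 'I_q -> R[i]) (T : R) :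
  \sum_(j < q) gamma j = T -> T != 0 -> (forall j, complex.Im (z j) != 0) ->
  exists M, forall t,
    `|point_charge_field gamma z t / T - 2^-1 * ln (1 + t ^+ 2)| <= M.
Proof.
move=> hT T0 hz.
have /choice[L H] : forall j, exists L, forall t, `|ln ((t - complex.Re (z j)) ^+ 2 +
    `|complex.Im (z j)| ^+ 2) - ln (1 + t ^+ 2)| <= L.
  by move=> j; apply: ln_sqr_shift_bounded; rewrite normr_eq0.
exists (\sum_(j < q) `|gamma j / T * 2^-1| * L j) => t.
have -> : point_charge_field gamma z t / T - 2^-1 * ln (1 + t ^+ 2) =
  \sum_(j < q) (gamma j / T * 2^-1) * (ln ((t - complex.Re (z j)) ^+ 2 +
    `|complex.Im (z j)| ^+ 2) - ln (1 + t ^+ 2)).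
  under eq_bigr do rewrite mulrBr.
  rewrite sumrB -!mulr_suml hT divff// mul1r; congr (_ - _).
  rewrite point_charge_fieldE// mulr_suml; apply: eq_bigr => j _.
  by rewrite addr0; ring.
apply: le_trans (ler_norm_sum _ _ _) _; apply: ler_sum => j _.
by rewrite normrM ler_wpM2l// H.
Qed.

(** With p = (x - a) ^+ 2 + b ^+ 2 and k = 2 b e + e ^+ 2, the difference is
    ln (1 + k / p), which lies between k / (p + k) and k / p; both are
    k / x ^+ 2 up to O(1 / |x| ^+ 3). *)
Lemma ln_sqr_incr_asymptotics (R : realType) (a b e : R) : 0 < b -> 0 < e ->
  exists L N, forall x, N <= `|x| ->
    `|x ^+ 2 * (ln ((x - a) ^+ 2 + (b + e) ^+ 2) - ln ((x - a) ^+ 2 + b ^+ 2))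
      - (2 * b * e + e ^+ 2)| <= L / `|x|.
Proof.
move=> b0 e0; pose k := 2 * b * e + e ^+ 2.
have k0 : 0 < k by rewrite /k addr_gt0 ?exprn_gt0// !mulr_gt0.
pose S := a ^+ 2 + b ^+ 2 + k + 2 * `|a|.
have S0 : 0 <= S by rewrite /S !addr_ge0 ?sqr_ge0 ?mulr_ge0// ltW.
(* For |x| >= 2 |a| one has p >= x ^+ 2 / 4, whence the factor 4. *)
exists (4 * k * S), (2 * `|a| + 1) => x; set y := `|x| => hy.
have A0 : 0 <= `|a| by [].
have y1 : 1 <= y by lra.
have y0 : 0 < y by lra.
have x2 : x ^+ 2 = y ^+ 2 by rewrite /y real_normK ?num_real.
have a2 : a ^+ 2 = `|a| ^+ 2 by rewrite real_normK ?num_real.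
pose p := (x - a) ^+ 2 + b ^+ 2.
have p0 : 0 < p by apply: sqrD_sqr_gt0; rewrite gt_eqF.
have pk0 : 0 < p + k by rewrite addr_gt0.
have -> : (x - a) ^+ 2 + (b + e) ^+ 2 = p + k by rewrite /p /k; ring.
have ax : `|a * x| <= `|a| * y by rewrite normrM.
move: ax; rewrite ler_norml => /andP[ax1 ax2].
have pE : p = y ^+ 2 - 2 * (a * x) + a ^+ 2 + b ^+ 2 by rewrite -x2 /p; ring.
have b2 : 0 < b ^+ 2 by rewrite exprn_gt0.
have p4 : y ^+ 2 / 4 <= p.
  have h : 0 <= (y / 2 - `|a|) * (3 * y / 2 - `|a|) by apply: mulr_ge0; lra.
  by rewrite pE a2; nra.
have LS : k * S * y ^+ 2 <= 4 * k * S * p.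
  have : 0 <= 4 * k * S * (p - y ^+ 2 / 4).
    by rewrite mulr_ge0 ?subr_ge0// !mulr_ge0// ltW.
  nra.
have up : ln (p + k) - ln p <= k / p.
  rewrite -ln_div ?posrE// mulrDl divff ?gt_eqF// le_ln1Dx//.
  by apply: lt_trans (divr_gt0 k0 p0); rewrite ltrN10.
have low : k / (p + k) <= ln (p + k) - ln p.
  rewrite -lerN2 opprB -ln_div ?posrE//.
  have -> : p / (p + k) = 1 + - (k / (p + k)) by field; rewrite gt_eqF.
  apply: le_ln1Dx; rewrite ltrN2 ltr_pdivrMr// mul1r; lra.
have Q0 : 0 <= a ^+ 2 + b ^+ 2 + k by have := sqr_ge0 a; lra.
have y2 : 0 < y ^+ 2 by rewrite exprn_gt0.
have yy : y <= y ^+ 2 by rewrite expr2 ler_peMl// ltW.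
rewrite x2 ler_norml; apply/andP; split.
  rewrite lerBrDr (le_trans _ (ler_wpM2l (ltW y2) low))//.
  rewrite mulrA ler_pdivlMr// -(ler_pM2r y0).
  have -> : (- (4 * k * S / y) + k) * (p + k) * y = (k * y - 4 * k * S) * (p + k).
    by field; rewrite gt_eqF.
  have h1 : p + k - y ^+ 2 <= S * y.
    have h2 : 0 <= (a ^+ 2 + b ^+ 2 + k) * (y - 1).
      by rewrite mulr_ge0 ?subr_ge0.
    by rewrite pE /S; nra.
  have h3 : 0 <= k * y * (S * y - (p + k - y ^+ 2)).
    by rewrite mulr_ge0 ?subr_ge0// mulr_ge0// ltW.
  have h4 : 0 <= 4 * k * S * k by rewrite !mulr_ge0// ltW.
  nra.
rewrite lerBlDr (le_trans (ler_wpM2l (ltW y2) up))//.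
rewrite mulrA ler_pdivrMr// -(ler_pM2r y0).
have -> : (4 * k * S / y + k) * p * y = (k * y + 4 * k * S) * p.
  by field; rewrite gt_eqF.
have h1 : y ^+ 2 - p <= S * y.
  have h2 : 0 <= (a ^+ 2 + b ^+ 2 + k) * y.
    by rewrite mulr_ge0// ltW.
  by rewrite pE /S; nra.
have h3 : 0 <= k * y * (S * y - (y ^+ 2 - p)).
  by rewrite mulr_ge0 ?subr_ge0// mulr_ge0// ltW.
nra.
Qed.

(** Let S < 0 be the sum of the gamma j * |Im (z j)|.  Raising the field to height e
    changes it by (e S + T e ^+ 2 / 2) / x ^+ 2 to leading order.  At e = - S / T, where
    this is smallest, it equals - 2 c / x ^+ 2; half of it is given up to the error
    terms. *)
Lemma charge_field_above_lt (R : realType) (q : nat)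
    (gamma : 'I_q -> R) (z : 'I_q -> R[i]) (T : R) :
  \sum_(j < q) gamma j = T -> 0 < T -> (forall j, complex.Im (z j) != 0) ->
  \sum_(j < q) gamma j * `|complex.Im (z j)| < 0 ->
  exists e c A, [/\ 0 < e, 0 < c, 0 < A & forall x, A < `|x| ->
    c / x ^+ 2 <= point_charge_field gamma z x - charge_field_above R q gamma z e x].
Proof.
move=> hT T0 hz; set S := \sum_(j < q) _ => S0.
pose e := - S / T; have e0 : 0 < e by rewrite divr_gt0// oppr_gt0.
pose b j := `|complex.Im (z j)|; have b0 j : 0 < b j by rewrite normr_gt0.
pose D j x := ln ((x - complex.Re (z j)) ^+ 2 + (b j + e) ^+ 2)
  - ln ((x - complex.Re (z j)) ^+ 2 + b j ^+ 2).
have /choice[LN H] : forall j, exists LN : R * R, forall x, LN.2 <= `|x| ->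
    `|x ^+ 2 * D j x - (2 * b j * e + e ^+ 2)| <= LN.1 / `|x|.
  move=> j; have [L [N h]] := ln_sqr_incr_asymptotics R (complex.Re (z j)) (b j) e (b0 j) e0.
  by exists (L, N).
pose L := \sum_(j < q) `|gamma j / 2| * (LN j).1.
pose N := \sum_(j < q) `|(LN j).2|.
pose c := S ^+ 2 / T / 4.
have S2 : 0 < S ^+ 2 by rewrite exprn_even_gt0//= lt_eqF.
have c0 : 0 < c by rewrite /c !divr_gt0.
pose A := N + `|L| / c + 1.
have N0 : 0 <= N by apply: sumr_ge0.
have Lc0 : 0 <= `|L| / c by rewrite divr_ge0// ltW.
exists e, c, A; split => //; first by rewrite /A; lra.
move=> x Ax; have x0 : 0 < `|x| by apply: lt_trans Ax; rewrite /A; lra.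
have x2 : 0 < x ^+ 2 by rewrite -(real_normK (num_real x)) exprn_gt0.
have sumE : point_charge_field gamma z x - charge_field_above R q gamma z e x =
    - \sum_(j < q) gamma j / 2 * D j x.
  rewrite point_charge_fieldE// -sumrB -sumrN; apply: eq_bigr => j _.
  by rewrite addr0 /D /b; ring.
have key : `|x ^+ 2 * (\sum_(j < q) gamma j / 2 * D j x) + 2 * c| <= L / `|x|.
  have -> : x ^+ 2 * (\sum_(j < q) gamma j / 2 * D j x) + 2 * c =
      \sum_(j < q) gamma j / 2 * (x ^+ 2 * D j x - (2 * b j * e + e ^+ 2)).
    have -> : 2 * c = - \sum_(j < q) gamma j / 2 * (2 * b j * e + e ^+ 2).
      rewrite (eq_bigr (fun j => gamma j * b j * e + gamma j * (e ^+ 2 / 2))); last first.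
        by move=> j _; field.
      rewrite big_split/= -!mulr_suml hT -/S /c /e.
      by field; rewrite gt_eqF.
    rewrite mulr_sumr -sumrB; apply: eq_bigr => j _; ring.
  apply: le_trans (ler_norm_sum _ _ _) _; rewrite /L mulr_suml.
  apply: ler_sum => j _; rewrite normrM -[leRHS]mulrA ler_wpM2l//.
  apply: H; apply: le_trans (ltW Ax); rewrite /A.
  have : `|(LN j).2| <= N.
    by rewrite /N (bigD1 j)//= lerDl; apply: sumr_ge0.
  have := ler_norm (LN j).2; lra.
have Lx : L / `|x| <= c.
  rewrite ler_pdivrMr//; have := ler_norm L.
  have : `|L| / c < `|x| by apply: le_lt_trans Ax; rewrite /A; lra.
  by rewrite ltr_pdivrMr// mulrC; lra.
rewrite sumE ler_pdivrMr//.
move: key; rewrite ler_norml => /andP[_]; lra.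
Qed.

(** * Compactness of the support *)

Lemma measurable_point_charge_field (R : realType) (q : nat)
    (gamma : 'I_q -> R) (z : 'I_q -> R[i]) : (forall j, complex.Im (z j) != 0) ->
  measurable_fun [set: R] (point_charge_field gamma z).
Proof.
move=> hz; have -> : point_charge_field gamma z = (fun x => \sum_(j < q)
    (gamma j * (2^-1 * ln ((x - complex.Re (z j)) ^+ 2 + `|complex.Im (z j)| ^+ 2)))).
  apply/funext => x; rewrite point_charge_fieldE//; apply: eq_bigr => j _.
  by rewrite addr0.
apply: measurable_sum => j; apply: measurable_funM => //; apply: measurable_funM => //.
apply: measurableT_comp; first exact: measurable_ln.
by apply: measurable_funD => //; apply: measurable_funX; exact: measurable_funB.
Qed.

Lemma closed_measure_support (R : realType) (mu : borel_measure R) :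
  closed (measure_support mu).
Proof.
rewrite -[measure_support mu]setCK closedC openE => x /=.
rewrite /measure_support/= => /existsNP[U] /not_implyP[oU] /not_implyP[Ux muU].
rewrite /interior; apply: filterS (open_nbhs_nbhs (conj oU Ux)) => y Uy /=.
by move/(_ U oU Uy).
Qed.

Theorem theorem2p1 (R : realType) (q : nat) (hq : (1 <= q)%N)
  (gamma : 'I_q -> R) (T : R) (hT : \sum_(j < q) gamma j = T) (T_gt0 : 0 < T)
  (z : 'I_q -> R[i]) (hz : forall j : 'I_q, complex.Im (z j) != 0)
  (mu : borel_measure R)
  (hmu : is_equilibrium_measure (point_charge_field gamma z) T mu)
  (hneg : \sum_(j < q) gamma j * `|complex.Im (z j)| < 0) :
  compact (measure_support mu).
Proof.
have [[muT mumin] _] := hmu; set Q := point_charge_field gamma z in mumin.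
have [e [c [A [e0 c0 A0 drop]]]] := charge_field_above_lt _ _ _ _ _ hT T_gt0 hz hneg.
have [M hM] := charge_field_weakly_admissible _ _ _ _ _ hT (lt0r_neq0 T_gt0) hz.
have mQ : measurable_fun [set: R] Q := measurable_point_charge_field _ _ _ _ hz.
have muoo : (mu setT < +oo)%E by rewrite muT ltry.
have [mu' mu'E] := ex_finite_measure _ _ _ mu muoo.
have Wmu : weighted_energy Q T mu' = weighted_energy Q T mu.
  rewrite /weighted_energy (eq_measure_integral mu) => [|B _ _]; last exact: mu'E.
  by apply: eq_integral => y _; apply: eq_measure_integral => B _ _; exact: mu'E.
have mu'min : energy_minimizer Q T mu'.
  by split; [exact: etrans (mu'E setT) muT|move=> sigma sT; rewrite Wmu; exact: mumin].
apply: (subclosed_compact (closed_measure_support _ mu) (@segment_compact R (- A) A)).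
move=> x suppx; rewrite /= in_itv/= -ler_norml leNgt; apply/negP => Ax.
pose B : set R := [set y | A < `|y| /\ `|y| < `|x| + 1].
have oB : open B.
  have -> : B = (fun y : R => `|y|) @^-1` [set` `]A, (`|x| + 1)[%R].
    by apply/seteqP; split => y /=; rewrite in_itv/= => /andP.
  by apply: open_comp => [y _|]; [exact: norm_continuous|exact: interval_open].
have mB : measurable (B : set (measurableTypeR R)) by exact: open_measurable.
have x10 : 0 < `|x| + 1 by rewrite ltr_wpDl.
pose eta := c / (`|x| + 1) ^+ 2 / T.
have eta0 : 0 < eta by rewrite !divr_gt0// exprn_gt0.
have muB0 : mu' B = 0%E.
  apply: (minimizer_null_of_field_drop _ Q (charge_field_above R q gamma z e) T M
    (charge_field_above R q gamma z 1 0) e eta) => //.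
  - exact: poisson_average_charge_field.
  - by move=> y _; exact: poisson_average_charge_field.
  - move=> y [Ay yx]; rewrite /eta ler_pM2r ?invr_gt0//.
    apply: le_trans (drop y Ay); rewrite ler_pM2l// lef_pV2 ?posrE.
    + by rewrite -(real_normK (num_real y)) ler_pXn2r ?nnegrE ?(ltW yx) ?(ltW x10).
    + by rewrite exprn_gt0.
    + by rewrite -(real_normK (num_real y)) exprn_gt0// (lt_trans A0).
have Bx : B x by split => //; rewrite ltrDl.
by have := suppx B oB Bx; rewrite -mu'E muB0 ltxx.
Qed.
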